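(* Let $\mathcal{M}$ be a smooth 4-dimensional manifold, and let $g_{ab}$ and $\tilde g_{ab}$ be smooth pseudo-Riemannian metrics on $\mathcal{M}$ with $g_{ab}=\Theta^2\tilde g_{ab}$ for a smooth positive function $\Theta$. Assume that $C_{abcd}C^{abcd}\neq0$ at every point, where $C_{abcd}$ is the Weyl tensor of $g_{ab}$. Let $w\in C^\infty(\mathcal{M})$ be a scalar metric concomitant of $g_{ab}$, with counterpart $\tilde w$ for $\tilde g_{ab}$, which is conformally covariant of weight $s\in\mathbb{Z}$, i.e. $\tilde w=\Theta^sw$. Then the operator $D^s_aw=\nabla_aw+s\Lambda_aw$ is conformally covariant: $$\tilde D^s_a\tilde w=\Theta^sD^s_aw .$$
   Context: Abstract index notation is used; square brackets denote antisymmetrization with weight one. A metric concomitant is a tensorial object defined exclusively in terms of a metric and its Levi-Civita connection; its counterpart for $\tilde g_{ab}$ (denoted with a tilde) is the object given by the same construction applied to $\tilde g_{ab}$ and its Levi-Civita connection $\tilde\nabla$. For a pseudo-Riemannian metric $g_{ab}$ with Levi-Civita connection $\nabla$, indices being raised and lowered with $g_{ab}$, the curvature conventions are: $\nabla_a\nabla_b\omega_c-\nabla_b\nabla_a\omega_c=R_{abc}{}^d\omega_d$; $R_{ac}=R_{abc}{}^b$; $R=g^{ab}R_{ab}$; Schouten tensor $L_{ab}=\frac12(R_{ab}-\frac16Rg_{ab})$; Weyl tensor $C_{abc}{}^d=R_{abc}{}^d-2L^d{}_{[b}g_{a]c}-2\delta^d{}_{[b}L_{a]c}$. Where $C\cdot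 C=C_{abcd}C^{abcd}$ is nowhere zero, define the covector field $$\Lambda_d=\frac{8\,C_d{}^{amp}\nabla_{[m}L_{p]a}}{C\cdot C}.$$ The covector $\tilde\Lambda_d$ is given by the same formula with every object (Levi-Civita connection, curvature tensors, index raising) constructed from $\tilde g_{ab}$, and $\tilde D^s_a\tilde w=\tilde\nabla_a\tilde w+s\tilde\Lambda_a\tilde w$. *)

(* Defs.v *)
From HB Require Import structures.
From mathcomp Require Import all_boot all_order all_algebra.
From mathcomp Require Import all_classical all_reals all_analysis.

Set Implicit Arguments.
Unset Strict Implicit.
Unset Printing Implicit Defensive.
Import Order.TTheory GRing.Theory Num.Theory.
Import numFieldNormedType.Exports.

Local Open Scope classical_set_scope.
Local Open Scope ring_scope.

Section CoordinateCalculus.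
Context {R : realType}.
Local Notation V := 'rV[R]_4.

Definition partial (a : 'I_4) (f : V -> R) : V -> R :=
  fun y => 'D_(delta_mx 0 a) f y.

Definition iter_partial (I : seq 'I_4) (f : V -> R) : V -> R :=
  foldr partial f I.

Definition smooth_on (O : set V) (f : V -> R) :=
  forall (I : seq 'I_4) (y : V), O y ->
    {for y, continuous (iter_partial I f)} /\
    forall a : 'I_4, derivable (iter_partial I f) y (delta_mx 0 a).

Definition smooth_map_on (O : set V) (f : V -> V) :=
  forall j : 'I_4, smooth_on O (fun y => f y 0 j).

(* Weight-one antisymmetrization: [alt T a b] is T_{[ab]}. *)
Definition alt (T : 'I_4 -> 'I_4 -> R) (a b : 'I_4) : R :=
  (T a b - T b a) / 2%:R.

Definition kronecker (a b : 'I_4) : R := (a == b)%:R.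

(* Below, [h] is the matrix of components of a metric in some coordinates, and
   tensor fields are given by their components; index arguments are in the
   order of the abstract indices, up or down as indicated. *)
Section Curvature.
Variable h : V -> 'M[R]_4.

(* g^{ab} *)
Definition metric_inv (y : V) (a b : 'I_4) : R := invmx (h y) a b.

(* [christoffel y a b c] is Gamma^c_{ab}. *)
Definition christoffel (y : V) (a b c : 'I_4) : R :=
  2%:R^-1 * \sum_(d < 4) metric_inv y c d *
    (partial a (fun z => h z b d) y + partial b (fun z => h z a d) y
     - partial d (fun z => h z a b) y).

(* nabla_a omega_b *)
Definition nabla1 (omega : V -> 'I_4 -> R) (y : V) (a b : 'I_4) : R :=
  partial a (fun z => omega z b) y
  - \sum_(d < 4) christoffel y a b d * omega y d.

(* nabla_a T_{bc} *)
Definition nabla2 (T : V -> 'I_4 -> 'I_4 -> R) (y : V) (a b c : 'I_4) : R :=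
  partial a (fun z => T z b c) y
  - (\sum_(d < 4) christoffel y a b d * T y d c)
  - \sum_(d < 4) christoffel y a c d * T y b d.

(* R_{abc}^d, read off from
     nabla_a nabla_b omega_c - nabla_b nabla_a omega_c = R_{abc}^d omega_d
   by taking for omega the coordinate covector field dx^d. *)
Definition riemann (y : V) (a b c d : 'I_4) : R :=
  let dx := fun (_ : V) (e : 'I_4) => kronecker e d in
  nabla2 (nabla1 dx) y a b c - nabla2 (nabla1 dx) y b a c.

Definition ricci (y : V) (a c : 'I_4) : R := \sum_(b < 4) riemann y a b c b.

Definition scalar_curvature (y : V) : R :=
  \sum_(a < 4) \sum_(b < 4) metric_inv y a b * ricci y a b.

Definition schouten (y : V) (a b : 'I_4) : R :=
  2%:R^-1 * (ricci y a b - 6%:R^-1 * scalar_curvature y * h y a b).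

(* L^d_b *)
Definition schouten_up (y : V) (d b : 'I_4) : R :=
  \sum_(e < 4) metric_inv y d e * schouten y e b.

(* C_{abc}^d *)
Definition weyl (y : V) (a b c d : 'I_4) : R :=
  riemann y a b c d
  - 2%:R * alt (fun b a => schouten_up y d b * h y a c) b a
  - 2%:R * alt (fun b a => kronecker d b * schouten y a c) b a.

(* C_{abcd} *)
Definition weyl_down (y : V) (a b c d : 'I_4) : R :=
  \sum_(e < 4) weyl y a b c e * h y e d.

(* C_a^{bcd} *)
Definition weyl_up3 (y : V) (a b c d : 'I_4) : R :=
  \sum_(e < 4) \sum_(f < 4) metric_inv y b e * metric_inv y c f * weyl y a e f d.

(* C^{abcd} *)
Definition weyl_up (y : V) (a b c d : 'I_4) : R :=
  \sum_(e < 4) metric_inv y a e * weyl_up3 y e b c d.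

(* C_{abcd} C^{abcd} *)
Definition weyl_square (y : V) : R :=
  \sum_(a < 4) \sum_(b < 4) \sum_(c < 4) \sum_(d < 4)
    weyl_down y a b c d * weyl_up y a b c d.

Definition Lambda (y : V) (d : 'I_4) : R :=
  8%:R * (\sum_(a < 4) \sum_(m < 4) \sum_(p < 4)
    weyl_up3 y d a m p * alt (fun m p => nabla2 schouten y m p a) m p)
  / weyl_square y.

(* Components at [y], in the coordinates at hand, of the metric and of its
   Levi-Civita connection, with their partial derivatives of order at most
   [k]. *)
Definition metric_jet (k : nat) (y : V) (I : seq 'I_4) : 'M[R]_4 :=
  if (size I <= k)%N then \matrix_(a, b) iter_partial I (fun z => h z a b) y
  else 0.

Definition connection_jet (k : nat) (y : V) (I : seq 'I_4) (a b c : 'I_4) : R :=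
  if (size I <= k)%N then iter_partial I (fun z => christoffel z a b c) y
  else 0.

End Curvature.
End CoordinateCalculus.

Section Manifold.
Variable R : realType.
Local Notation V := 'rV[R]_4.

(* Only the values of [chart_map] on [chart_dom], and those of [chart_inv] on
   the image of [chart_dom], are meaningful. *)
Record chart (M : topologicalType) := Chart {
  chart_dom : set M;
  chart_map :> M -> V;
  chart_inv : V -> M;
  chart_cod := chart_map @` chart_dom;
  chart_dom_open : open chart_dom;
  chart_cod_open : open chart_cod;
  chart_mapK : forall x, chart_dom x -> chart_inv (chart_map x) = x;
  chart_map_continuous : {within chart_dom, continuous chart_map};
  chart_inv_continuous : {within chart_cod, continuous chart_inv} }.

Definition smooth_transition (M : topologicalType) (c c' : chart M) :=
  smooth_map_on (c @` (chart_dom c `&` chart_dom c')) (c' \o chart_inv c).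

Definition compatible (M : topologicalType) (c c' : chart M) :=
  smooth_transition c c' /\ smooth_transition c' c.

(* The atlas is the maximal one: it contains every admissible coordinate
   system. *)
Record manifold4 := Manifold4 {
  carrier :> topologicalType;
  atlas : set (chart carrier);
  carrier_hausdorff : hausdorff_space carrier;
  carrier_second_countable : @second_countable carrier;
  atlas_cover : forall x : carrier, exists2 c, atlas c & chart_dom c x;
  atlas_compatible : forall c c', atlas c -> atlas c' -> compatible c c';
  atlas_maximal :
    forall c, (forall c', atlas c' -> compatible c c') -> atlas c }.

Variable M : manifold4.

Definition smooth_fun (f : M -> R) :=
  forall c, atlas c -> smooth_on (chart_cod c) (f \o chart_inv c).

(* [metric_comp c x] is the matrix of components at [x] in the chart [c]. *)
Record metric := Metric {
  metric_comp : chart M -> M -> 'M[R]_4;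
  metric_sym : forall c x, atlas c -> chart_dom c x ->
    (metric_comp c x)^T = metric_comp c x;
  metric_nondegenerate : forall c x, atlas c -> chart_dom c x ->
    metric_comp c x \in unitmx;
  metric_smooth : forall c (a b : 'I_4), atlas c ->
    smooth_on (chart_cod c) (fun y => metric_comp c (chart_inv c y) a b);
  metric_tensorial : forall c c' x, atlas c -> atlas c' ->
    chart_dom c x -> chart_dom c' x ->
    let J := 'J (c' \o chart_inv c) (c x) in
    metric_comp c x = J *m metric_comp c' x *m J^T }.

Definition in_chart (g : metric) (c : chart M) : V -> 'M[R]_4 :=
  fun y => metric_comp g c (chart_inv c y).

(* A scalar built exclusively from a metric and its Levi-Civita connection: one
   expression [F] in the components of the metric, of the connection and of
   finitely many of their partial derivatives gives its value for all metrics
   and in all coordinate systems. *)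
Definition scalar_metric_concomitant (W : metric -> M -> R) :=
  exists (k : nat) (F : (seq 'I_4 -> 'M[R]_4) ->
                        (seq 'I_4 -> 'I_4 -> 'I_4 -> 'I_4 -> R) -> R),
  forall (g : metric) (c : chart M) (x : M), atlas c -> chart_dom c x ->
    W g x = F (metric_jet (in_chart g c) k (c x))
              (connection_jet (in_chart g c) k (c x)).

Definition conformally_related (g gt : metric) (Theta : M -> R) :=
  forall (c : chart M) (x : M), atlas c -> chart_dom c x ->
    metric_comp g c x = Theta x ^+ 2 *: metric_comp gt c x.

Definition weyl_square_nowhere_zero (g : metric) :=
  forall (c : chart M) (x : M), atlas c -> chart_dom c x ->
    weyl_square (in_chart g c) (c x) != 0.

(* Component [a] in the chart [c] of nabla_a w + s Lambda_a w. *)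
Definition D_op (g : metric) (s : int) (w : M -> R) (c : chart M) (x : M)
    (a : 'I_4) : R :=
  partial a (w \o chart_inv c) (c x)
  + s%:~R * Lambda (in_chart g c) (c x) a * w x.

End Manifold.

(* Main.v *)
Require Import Defs.
From HB Require Import structures.
From mathcomp Require Import all_boot all_order all_algebra.
From mathcomp Require Import all_classical all_reals all_analysis.
From mathcomp Require Import perm ring lra.

(** Put U_a = d_a ln Theta and take gt as the base metric, so that
    g = Theta^2 gt. The theorem follows from the inhomogeneous rule

      Lambda_a(g) = Lambda_a(gt) + U_a                          [Lambda_conf]

    because the Leibniz rule gives d_a (Theta^s w) = Theta^s (d_a w + s U_a w),
    and the term s U_a w is what turns Lambda(gt) into Lambda(g).

    The rule is obtained in one chart, by following the curvature through the
    rescaling. The Christoffel symbols change by the tensor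
    S^c_{ab} = delta^c_a U_b + delta^c_b U_a - gt_{ab} U^c; with
    P_{ab} = U_a U_b - nabla_a U_b - (1/2) U^c U_c gt_{ab} this gives

      R'_{abc}^d = R_{abc}^d + P^d_b gt_{ac} - P^d_a gt_{bc}
                   + delta^d_b P_{ac} - delta^d_a P_{bc}         [Riem_conf]

    whose traces say that the Schouten tensor changes by exactly P [Sch_conf];
    hence the Weyl tensor C_{abc}^d is invariant [Weyl_conf]. In the derivative
    of P the Ricci identity produces the curvature, and everything else
    assembles it into the Weyl tensor: the Cotton tensor
    Y_{mpa} = 2 nabla_[m L_p]a becomes Y_{mpa} - C_{mpa}^f U_f [cotton_conf].
    So the numerator of Lambda_d is shifted by -4 C_d^{amp} C_{mpa}^f U_f. Here
    the dimension enters: for a trace-free X_{ab}^{cd} in dimension four, the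
    contraction X_{da}^{mp} X_{mp}^{ea} is a quarter of its own trace times
    delta_d^e [square_traceE], so that the shift equals (C.C) U_d
    [Weyl_contraction] and division by C.C leaves U_d.

    The analytic input is small: functions smooth on an open set form a ring
    closed under partial derivatives, and partial derivatives commute
    [partialC]. Commutation is used for the metric (which gives R_{abcd} its
    antisymmetry in c, d), for ln Theta, and for its gradient. *)

Set Implicit Arguments.
Unset Strict Implicit.
Unset Printing Implicit Defensive.
Import Order.TTheory GRing.Theory Num.Theory.
Import numFieldNormedType.Exports.

Local Open Scope classical_set_scope.
Local Open Scope ring_scope.

(** * Smooth functions on an open set *)

Section SmoothFunctions.
Variable R : realType.
Local Notation V := 'rV[R]_4.
Implicit Types (O : set V) (f g : V -> R) (a b : 'I_4) (y : V).

Definition regular_at f y :=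
  {for y, continuous f} /\ forall a, derivable f y (delta_mx 0 a).

(** Order-bounded form of smoothness, with the first derivative taken innermost:
closure properties go by induction on [n], a derivative of a product being
a combination of products of one order less. *)
Fixpoint Cdiff (n : nat) O f : Prop :=
  (forall y, O y -> regular_at f y) /\
  if n is m.+1 then forall a, Cdiff m O (partial a f) else True.

(** In [iter_partial] the head of the list is the last derivative taken, hence the
decomposition of the list at its other end. *)
Lemma smooth_onP O f : smooth_on O f <-> forall n, Cdiff n O f.
Proof.
split=> [+ n|fn I].
  elim: n f => [|n IHn] f fO /=; first by split=> // y; exact: (fO [::]).
  split=> [y|a]; first exact: (fO [::]).
  apply: IHn => I y; rewrite (_ : iter_partial I _ = iter_partial (rcons I a) f).
    exact: fO.
  by rewrite /iter_partial foldr_rcons.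
elim/last_ind: I f fn => [|I a IHI] f fn y Oy; first exact: (fn 0).1.
rewrite /iter_partial foldr_rcons; apply: IHI => // n.
exact: (fn n.+1).2.
Qed.

Lemma Cdiff_le n O f : Cdiff n.+1 O f -> Cdiff n O f.
Proof.
elim: n f => [|n IHn] f [f0 fS]; split=> // a; exact/IHn/fS.
Qed.

Lemma near_eq_on O f g y : open O -> (forall z, O z -> f z = g z) -> O y ->
  {near y, f =1 g}.
Proof.
move=> Oo fg Oy; near=> z; apply: fg; near: z; exact: open_nbhs_nbhs.
Unshelve. all: by end_near.
Qed.

Lemma eq_partial O f g a y : open O -> (forall z, O z -> f z = g z) -> O y ->
  partial a f y = partial a g y.
Proof.
move=> Oo fg Oy; exact/near_eq_derive/(near_eq_on Oo fg Oy).
Qed.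

Lemma regular_ext O f g y : open O -> (forall z, O z -> f z = g z) -> O y ->
  regular_at f y -> regular_at g y.
Proof.
move=> Oo fg Oy [fc fd]; have nfg := near_eq_on Oo fg Oy.
split=> [|a]; last exact: near_eq_derivable (fd a).
rewrite /prop_for /continuous_at -(fg y Oy).
exact: cvg_trans (near_eq_cvg nfg) fc.
Qed.

Lemma Cdiff_ext n O f g : open O -> (forall z, O z -> f z = g z) ->
  Cdiff n O f -> Cdiff n O g.
Proof.
move=> Oo; elim: n f g => [|n IHn] f g fg [f0 fS].
all: split=> [y Oy|//a]; first exact: regular_ext fg Oy (f0 y Oy).
by apply: IHn (fS a) => y Oy; exact: eq_partial fg Oy.
Qed.

Lemma partial_cst a (k : R) y : partial a (fun=> k) y = 0.
Proof. exact: derive_cst. Qed.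

Lemma Cdiff_cst n O (k : R) : Cdiff n O (fun=> k).
Proof.
elim: n k => [|n IHn] k; (split=> [y _|//a]; first by
  split=> [|a]; [exact: cst_continuous|exact: derivable_cst]).
by rewrite (_ : partial a _ = fun=> 0) //; apply/funext => y; exact: partial_cst.
Qed.

Lemma CdiffD n O f g : open O -> Cdiff n O f -> Cdiff n O g ->
  Cdiff n O (fun z => f z + g z).
Proof.
move=> Oo; elim: n f g => [|n IHn] f g [f0 fS] [g0 gS].
all: have fg0 y : O y -> regular_at (fun z => f z + g z) y by
  move=> /[dup]/f0[fc fd] /g0[gc gd];
  split=> [|a]; [exact: (cvgD fc gc)|exact: derivableD].
all: split=> // a.
apply: (Cdiff_ext Oo _ (IHn _ _ (fS a) (gS a))) => y Oy.
by rewrite {3}/partial deriveD //; [case: (f0 y Oy)|case: (g0 y Oy)].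
Qed.

Lemma CdiffM n O f g : open O -> Cdiff n O f -> Cdiff n O g ->
  Cdiff n O (fun z => f z * g z).
Proof.
move=> Oo; elim: n f g => [|n IHn] f g fn gn; have [f0 fS] := fn; have [g0 gS] := gn.
all: have fg0 y : O y -> regular_at (fun z => f z * g z) y by
  move=> /[dup]/f0[fc fd] /g0[gc gd];
  split=> [|a]; [exact: (cvgM fc gc)|exact: derivableM].
all: split=> // a.
have := CdiffD Oo (IHn _ _ (Cdiff_le fn) (gS a)) (IHn _ _ (Cdiff_le gn) (fS a)).
apply: Cdiff_ext => // y Oy.
by rewrite {3}/partial deriveM //; [case: (f0 y Oy)|case: (g0 y Oy)].
Qed.

Lemma CdiffV n O f : open O -> (forall y, O y -> f y != 0) -> Cdiff n O f ->
  Cdiff n O (fun z => (f z)^-1).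
Proof.
move=> Oo fn0; elim: n f fn0 => [|n IHn] f fn0 fn; have [f0 fS] := fn.
all: have fg0 y : O y -> regular_at (fun z => (f z)^-1) y by
  move=> /[dup] /fn0 fy /f0[fc fd];
  split=> [|a]; [exact: (cvgV fy fc)|exact: derivableV].
all: split=> // a.
have IV := IHn f fn0 (Cdiff_le fn).
have := CdiffM Oo (CdiffM Oo (Cdiff_cst n O (-1)) (CdiffM Oo IV IV)) (fS a).
apply: Cdiff_ext => // y Oy.
rewrite {2}/partial deriveV; [|exact: fn0|by case: (f0 y Oy)].
by rewrite mulN1r -exprVn expr2.
Qed.

Lemma is_derive_line f (x v : V) (s : R) : derivable f (s *: v + x) v ->
  is_derive s 1 (fun t => f (t *: v + x)) ('D_v f (s *: v + x)).
Proof.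
have E : (fun h : R => h^-1 *: (f ((h *: 1 + s) *: v + x) - f (s *: v + x))) =
    (fun h : R => h^-1 *: (f (h *: v + (s *: v + x)) - f (s *: v + x))).
  by apply/funext => h; rewrite scalerDl [h *: 1]mulr1 addrA.
by move=> dv; split; rewrite /derivable /derive E.
Qed.

Lemma near_plane (P : V -> Prop) (u v x : V) : (\near x, P x) ->
  exists2 r : R, 0 < r & forall c d : R, 0 <= c <= r -> 0 <= d <= r ->
    P (c *: u + (d *: v + x)).
Proof.
move=> /nbhs_ballP[e /= e0 eP]; pose k := `|u| + `|v| + 1.
have k0 : 0 < k by rewrite ltr_wpDl// addr_ge0.
(* The point is at distance at most r (|u| + |v|) < r k = e / 2 from x. *)
exists (e / (2 * k)); first by rewrite divr_gt0 ?mulr_gt0.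
set r := e / (2 * k) => c d /andP[c0 cr] /andP[d0 dr]; apply: eP.
rewrite -ball_normE /= addrA opprD addrCA subrr addr0 normrN.
apply: le_lt_trans (ler_normD _ _) _; rewrite !normrZ !ger0_norm//.
have rk : r * k = e / 2 by rewrite /r; field; rewrite gt_eqF.
apply: (@le_lt_trans _ _ (r * k)); last by rewrite rk; lra.
rewrite /k mulrDr mulr1 mulrDr -addrA; apply: lerD; first exact: ler_wpM2r.
by rewrite -[leLHS]addr0; apply: lerD; [exact: ler_wpM2r|exact: le_trans cr].
Qed.

(** The mean value theorem, used along [a] for the increment of [f] in the
direction [b] and then along [b] for the derivative of [f]. *)
Lemma second_difference O f a b y (t : R) : Cdiff 1 O f -> 0 < t ->
  (forall c d : R, 0 <= c <= t -> 0 <= d <= t ->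
     O (c *: delta_mx 0 a + (d *: delta_mx 0 b + y))) ->
  exists c d : R, [/\ 0 <= c <= t, 0 <= d <= t &
    f (t *: delta_mx 0 a + (t *: delta_mx 0 b + y)) - f (t *: delta_mx 0 a + y)
    - f (t *: delta_mx 0 b + y) + f y =
    t ^+ 2 * partial b (partial a f) (c *: delta_mx 0 a + (d *: delta_mx 0 b + y))].
Proof.
move=> [f0 fS] t0 box; set u := delta_mx 0 a : V; set v := delta_mx 0 b : V.
have tt : 0 <= t <= t by rewrite lexx ltW.
have zt : (0 : R) <= 0 <= t by rewrite lexx ltW.
pose phi (s : R) := f (s *: u + (t *: v + y)) - f (s *: u + y).
pose dphi (s : R) := partial a f (s *: u + (t *: v + y)) - partial a f (s *: u + y).
have box0 c : 0 <= c <= t -> O (c *: u + y).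
  by move=> ct; have := box _ _ ct zt; rewrite scale0r add0r.
have phi' s : 0 <= s <= t -> is_derive s 1 phi (dphi s).
  move=> st; apply: is_deriveB; apply: is_derive_line.
    exact: (f0 _ (box _ _ st tt)).2.
  exact: (f0 _ (box0 _ st)).2.
have itv_in s : s \in `]0, t[%R -> 0 <= s <= t.
  by rewrite in_itv/= => /andP[? ?]; rewrite !ltW.
have [||c /itv_in ct Ec] := MVT t0 (f := phi) (df := dphi).
- by move=> s /itv_in; exact: phi'.
- apply: derivable_within_continuous => s; rewrite in_itv/= => st.
  by have [] := phi' _ st.
pose psi (s : R) := partial a f (s *: v + (c *: u + y)).
pose dpsi (s : R) := partial b (partial a f) (s *: v + (c *: u + y)).
have swap s : s *: v + (c *: u + y) = c *: u + (s *: v + y) by rewrite addrCA.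
have psi' s : 0 <= s <= t -> is_derive s 1 psi (dpsi s).
  move=> st; apply: is_derive_line; rewrite swap.
  exact: ((fS a).1 _ (box _ _ ct st)).2.
have [||d /itv_in dt Ed] := MVT t0 (f := psi) (df := dpsi).
- by move=> s /itv_in; exact: psi'.
- apply: derivable_within_continuous => s; rewrite in_itv/= => st.
  by have [] := psi' _ st.
exists c, d; split=> //; rewrite -/u -/v -swap -/(dpsi d) expr2 -mulrA.
move: Ec Ed; rewrite /phi /dphi /psi !scale0r !add0r subr0 swap mulrC => Ec Ed.
by rewrite [X in t * X]mulrC -Ed -Ec; ring.
Qed.

(** The second difference quotient is symmetric in the two directions, and it is
a value of either mixed derivative at some point of the small square, so
continuity makes the two mixed derivatives agree at [y]. *)
Lemma partialC O f a b y : open O -> Cdiff 2 O f -> O y ->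
  partial a (partial b f) y = partial b (partial a f) y.
Proof.
move=> Oo fC Oy; set D := fun a b => partial a (partial b f).
have Dc i j : {for y, continuous (D i j)}.
  by have [+ _] := ((fC.2 j).2 i).1 y Oy.
apply/eqP; rewrite -subr_eq0 -normr_le0; apply/ler_addgt0Pl => e e0.
have e2 : 0 < e / 2 by rewrite divr_gt0.
have Onear : \near y, O y by exact: open_nbhs_nbhs.
have cv i j : \forall z \near y, `|D i j y - D i j z| < e / 2.
  by have /cvgrPdist_lt/(_ _ e2) := Dc i j.
have [r r0 box] := near_plane (delta_mx 0 a) (delta_mx 0 b)
  (filterI Onear (filterI (cv a b) (cv b a))).
have [|c [d [cr dr Eba]]] :=
  second_difference (a := a) (b := b) (y := y) (Cdiff_le fC) r0.
  by move=> c d cr dr; have [] := box _ _ cr dr.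
have [|d' [c' [dr' cr' Eab]]] :=
  second_difference (a := b) (b := a) (y := y) (Cdiff_le fC) r0.
  by move=> d' c' dr' cr'; rewrite addrCA; have [] := box _ _ cr' dr'.
have E : D a b (d' *: delta_mx 0 b + (c' *: delta_mx 0 a + y)) =
         D b a (c *: delta_mx 0 a + (d *: delta_mx 0 b + y)).
  apply: (mulfI (expf_neq0 2 (lt0r_neq0 r0))).
  rewrite -[LHS]Eab -[RHS]Eba (addrCA (r *: delta_mx 0 b)).
  by congr (_ + _); exact: addrAC.
have [_ [_ cba]] := box _ _ cr dr; have [_ [cab _]] := box _ _ cr' dr'.
move: cab cba; rewrite addrCA E; set X := D b a (_ + _) => cab cba.
rewrite addr0 (splitr e); apply: le_trans (ler_distD X _ _) _.
apply: lerD; apply: ltW; first exact: cab.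
by rewrite distrC; exact: cba.
Qed.

End SmoothFunctions.

(** * Closure properties and contraction of indices *)

(** A sealed copy of [partial]. Unification and [ring] compare terms up to
unfolding, which is prohibitively slow once derivatives unfold to limits of
difference quotients; the copies of the curvature tensors below are sealed
for the same reason. *)
Definition pd (R : realType) : 'I_4 -> ('rV[R]_4 -> R) -> 'rV[R]_4 -> R :=
  locked (@partial R).

Lemma partial_pd (R : realType) : @partial R = @pd R.
Proof. by rewrite /pd -lock. Qed.

Lemma eq_pd (R : realType) (O : set 'rV[R]_4) f g a y : open O ->
  (forall z, O z -> f z = g z) -> O y -> pd a f y = pd a g y.
Proof. by rewrite -partial_pd; exact: eq_partial. Qed.

Lemma pd_cst (R : realType) a (k : R) y : pd a (fun=> k) y = 0.
Proof. by rewrite -partial_pd partial_cst. Qed.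

Section SmoothClosure.
Variable R : realType.
Local Notation V := 'rV[R]_4.
Variable O : set V.
Hypothesis Oo : open O.
Implicit Types (f g : V -> R) (a b : 'I_4) (y : V).

Lemma smooth_derivable f a y : smooth_on O f -> O y ->
  derivable f y (delta_mx 0 a).
Proof. by move=> fO Oy; have [_] := fO [::] y Oy. Qed.

Lemma smooth_ext f g : (forall z, O z -> f z = g z) ->
  smooth_on O f -> smooth_on O g.
Proof.
by move=> fg /smooth_onP fO; apply/smooth_onP => n; exact: Cdiff_ext (fO n).
Qed.

Lemma smooth_cst (k : R) : smooth_on O (fun=> k).
Proof. by apply/smooth_onP => n; exact: Cdiff_cst. Qed.

Lemma smoothD f g : smooth_on O f -> smooth_on O g ->
  smooth_on O (fun z => f z + g z).
Proof.
move=> /smooth_onP fO /smooth_onP gO; apply/smooth_onP => n; exact: CdiffD.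
Qed.

Lemma smoothM f g : smooth_on O f -> smooth_on O g ->
  smooth_on O (fun z => f z * g z).
Proof.
move=> /smooth_onP fO /smooth_onP gO; apply/smooth_onP => n; exact: CdiffM.
Qed.

Lemma smoothV f : (forall y, O y -> f y != 0) -> smooth_on O f ->
  smooth_on O (fun z => (f z)^-1).
Proof. by move=> f0 /smooth_onP fO; apply/smooth_onP => n; exact: CdiffV. Qed.

Lemma smoothN f : smooth_on O f -> smooth_on O (fun z => - f z).
Proof.
move=> fO; apply: (smooth_ext _ (smoothM (smooth_cst (-1)) fO)) => z _.
by rewrite mulN1r.
Qed.

Lemma smoothB f g : smooth_on O f -> smooth_on O g ->
  smooth_on O (fun z => f z - g z).
Proof. by move=> fO gO; apply: smoothD => //; exact: smoothN. Qed.

Lemma smooth_sum (I : Type) (r : seq I) (F : I -> V -> R) :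
  (forall i, smooth_on O (F i)) -> smooth_on O (fun z => \sum_(i <- r) F i z).
Proof.
move=> FO; elim: r => [|i r IHr].
  by apply: smooth_ext (smooth_cst 0) => z _; rewrite big_nil.
by apply: smooth_ext (smoothD (FO i) IHr) => z _; rewrite big_cons.
Qed.

Lemma smooth_prod (I : Type) (r : seq I) (F : I -> V -> R) :
  (forall i, smooth_on O (F i)) -> smooth_on O (fun z => \prod_(i <- r) F i z).
Proof.
move=> FO; elim: r => [|i r IHr].
  by apply: smooth_ext (smooth_cst 1) => z _; rewrite big_nil.
by apply: smooth_ext (smoothM (FO i) IHr) => z _; rewrite big_cons.
Qed.

Lemma smooth_pd f a : smooth_on O f -> smooth_on O (pd a f).
Proof.
rewrite -partial_pd => /smooth_onP fO; apply/smooth_onP => n.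
exact: (fO n.+1).2.
Qed.

Lemma smooth_det n (A : V -> 'M[R]_n) :
  (forall i j, smooth_on O (fun z => A z i j)) ->
  smooth_on O (fun z => \det (A z)).
Proof.
move=> AO; apply: smooth_sum => s; apply: smoothM; first exact: smooth_cst.
by apply: smooth_prod => i; exact: AO.
Qed.

(** Cramer's rule: the entries of the inverse are cofactors over the determinant,
all polynomial in the entries of [A]. *)
Lemma smooth_invmx n (A : V -> 'M[R]_n) :
  (forall y, O y -> A y \in unitmx) ->
  (forall i j, smooth_on O (fun z => A z i j)) ->
  forall i j, smooth_on O (fun z => invmx (A z) i j).
Proof.
move=> Au AO i j.
have adjO : smooth_on O (fun z => \adj (A z) i j).
  apply: (@smooth_ext (fun z => cofactor (A z) j i)) => [z _|]; first by rewrite mxE.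
  apply: smoothM; first exact: smooth_cst.
  apply: smooth_det => k l.
  by apply: smooth_ext (AO (lift j k) (lift i l)) => z _; rewrite !mxE.
have det0 y : O y -> \det (A y) != 0 by move=> /Au; rewrite unitmxE unitfE.
have detO := smoothV det0 (smooth_det AO).
apply: (smooth_ext _ (smoothM detO adjO)) => z Oz.
by rewrite /invmx Au// [RHS]mxE.
Qed.

Lemma pdD f g a y : smooth_on O f -> smooth_on O g -> O y ->
  pd a (fun z => f z + g z) y = pd a f y + pd a g y.
Proof. by rewrite -partial_pd => fO gO Oy; apply: deriveD; exact: smooth_derivable. Qed.

Lemma pdN f a y : smooth_on O f -> O y ->
  pd a (fun z => - f z) y = - pd a f y.
Proof. by rewrite -partial_pd => fO Oy; apply: deriveN; exact: smooth_derivable. Qed.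

Lemma pdB f g a y : smooth_on O f -> smooth_on O g -> O y ->
  pd a (fun z => f z - g z) y = pd a f y - pd a g y.
Proof. by rewrite -partial_pd => fO gO Oy; apply: deriveB; exact: smooth_derivable. Qed.

Lemma pdM f g a y : smooth_on O f -> smooth_on O g -> O y ->
  pd a (fun z => f z * g z) y = f y * pd a g y + g y * pd a f y.
Proof. by rewrite -partial_pd => fO gO Oy; apply: deriveM; exact: smooth_derivable. Qed.

Lemma pdZ (k : R) f a y : smooth_on O f -> O y ->
  pd a (fun z => k * f z) y = k * pd a f y.
Proof.
by move=> fO Oy; rewrite pdM//; [rewrite pd_cst mulr0 addr0|exact: smooth_cst].
Qed.

Lemma pd_sum (I : Type) (r : seq I) (F : I -> V -> R) a y :
  (forall i, smooth_on O (F i)) -> O y ->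
  pd a (fun z => \sum_(i <- r) F i z) y = \sum_(i <- r) pd a (F i) y.
Proof.
move=> FO Oy; elim: r => [|i r IHr].
  rewrite big_nil -[RHS](pd_cst a (0 : R) y); congr pd.
  by apply/funext => z; rewrite big_nil.
rewrite big_cons -IHr -pdD//; last exact: smooth_sum.
by congr pd; apply/funext => z; rewrite big_cons.
Qed.

Lemma pdC f a b y : smooth_on O f -> O y ->
  pd a (pd b f) y = pd b (pd a f) y.
Proof. by rewrite -partial_pd => /smooth_onP fO Oy; exact: partialC (fO 2) Oy. Qed.

End SmoothClosure.

Section Contraction.
Variable R : realType.
Implicit Types (T : 'I_4 -> R) (a b : 'I_4).
Local Notation kron := (@kronecker R).

Lemma kroneckerC a b : kron a b = kron b a.
Proof. by rewrite /kronecker eq_sym. Qed.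

Lemma sum_kron_row T a : \sum_e kron a e * T e = T a.
Proof.
rewrite (bigD1 a)//= big1 => [|e ea]; first by rewrite /kronecker eqxx mul1r addr0.
by rewrite /kronecker eq_sym (negPf ea) mul0r.
Qed.

Lemma sum_kron_col T a : \sum_e kron e a * T e = T a.
Proof. by under eq_bigr do rewrite kroneckerC; exact: sum_kron_row. Qed.

Lemma kron_sum_row T a : \sum_e T e * kron a e = T a.
Proof. by under eq_bigr do rewrite mulrC; exact: sum_kron_row. Qed.

Lemma kron_sum_col T a : \sum_e T e * kron e a = T a.
Proof. by under eq_bigr do rewrite mulrC; exact: sum_kron_col. Qed.

Definition sum_kron := (sum_kron_row, sum_kron_col, kron_sum_row, kron_sum_col).

Lemma kronecker_trace : \sum_e kron e e = 4.
Proof.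
under eq_bigr do rewrite /kronecker eqxx.
by rewrite sumr_const card_ord.
Qed.

(** The four indices are handed over as variables, since concrete ordinals are
costly to compare. *)
Lemma sum4 : exists i j k l : 'I_4, forall T,
  \sum_e T e = T i + T j + T k + T l.
Proof.
exists ord0, (lift ord0 ord0), (lift ord0 (lift ord0 ord0)),
  (lift ord0 (lift ord0 (lift ord0 ord0))) => T.
by rewrite !big_ord_recl big_ord0 addr0 !addrA.
Qed.

Lemma sum_mulA (u v : 'I_4 -> R) (B : 'I_4 -> 'I_4 -> R) :
  \sum_d u d * (\sum_e B d e * v e) = \sum_e (\sum_d u d * B d e) * v e.
Proof.
under eq_bigr do rewrite mulr_sumr.
rewrite exchange_big; apply: eq_bigr => e _.
by rewrite mulr_suml; apply: eq_bigr => d _; rewrite mulrA.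
Qed.

Lemma exchange_sum_pairs (F : 'I_4 -> 'I_4 -> 'I_4 -> 'I_4 -> R) :
  \sum_a \sum_b \sum_c \sum_d F a b c d = \sum_c \sum_d \sum_a \sum_b F a b c d.
Proof.
under eq_bigr do rewrite exchange_big.
rewrite exchange_big/=; apply: eq_bigr => c _.
under eq_bigr do rewrite exchange_big.
by rewrite exchange_big.
Qed.

End Contraction.

(** * The Levi-Civita connection and its curvature *)

Definition metric_on (R : realType) (O : set 'rV[R]_4)
    (h : 'rV[R]_4 -> 'M[R]_4) :=
  [/\ forall a b, smooth_on O (fun y => h y a b),
      forall y, O y -> (h y)^T = h y &
      forall y, O y -> h y \in unitmx].

Definition ginv (R : realType) (h : 'rV[R]_4 -> 'M[R]_4) :
  'rV[R]_4 -> 'I_4 -> 'I_4 -> R := locked (metric_inv h).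

Definition Gam (R : realType) (h : 'rV[R]_4 -> 'M[R]_4) :
  'rV[R]_4 -> 'I_4 -> 'I_4 -> 'I_4 -> R := locked (christoffel h).

Definition Riem (R : realType) (h : 'rV[R]_4 -> 'M[R]_4) :
  'rV[R]_4 -> 'I_4 -> 'I_4 -> 'I_4 -> 'I_4 -> R := locked (riemann h).

(** Gamma_{dab} = h_{de} Gamma^e_{ab}: the lowered index comes first. *)
Definition Gam_down (R : realType) (h : 'rV[R]_4 -> 'M[R]_4) :
    'rV[R]_4 -> 'I_4 -> 'I_4 -> 'I_4 -> R :=
  locked (fun y d a b => \sum_e h y d e * Gam h y a b e).

Lemma metric_inv_ginv (R : realType) : @metric_inv R = @ginv R.
Proof. by apply/funext => h; rewrite /ginv -lock. Qed.

Lemma christoffel_Gam (R : realType) : @christoffel R = @Gam R.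
Proof. by apply/funext => h; rewrite /Gam -lock. Qed.

Lemma riemann_Riem (R : realType) : @riemann R = @Riem R.
Proof. by apply/funext => h; rewrite /Riem -lock. Qed.

Lemma Gam_downE (R : realType) h y d a b :
  Gam_down h y d a b = \sum_e (h : 'rV[R]_4 -> 'M[R]_4) y d e * Gam h y a b e.
Proof. by rewrite /Gam_down -lock. Qed.

Lemma GamE (R : realType) (h : 'rV[R]_4 -> 'M[R]_4) y a b c :
  Gam h y a b c = 2%:R^-1 * \sum_(d < 4) ginv h y c d *
    (pd a (fun z => h z b d) y + pd b (fun z => h z a d) y
     - pd d (fun z => h z a b) y).
Proof. by rewrite -christoffel_Gam /christoffel metric_inv_ginv partial_pd. Qed.

Section LeviCivita.
Variable R : realType.
Local Notation V := 'rV[R]_4.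
Variables (O : set V) (h : V -> 'M[R]_4).
Hypothesis Oo : open O.
Hypothesis hO : metric_on O h.
Implicit Types (a b c d e : 'I_4) (y : V).
Local Notation G := (Gam h).
Local Notation hi := (ginv h).

Lemma metric_onC y a b : O y -> h y a b = h y b a.
Proof. by case: hO => _ hs _ /hs hy; rewrite -[in LHS]hy mxE. Qed.

Lemma pd_metricC y a b c : O y ->
  pd a (fun z => h z b c) y = pd a (fun z => h z c b) y.
Proof. by move=> Oy; apply: (eq_pd _ Oo _ Oy) => z; exact: metric_onC. Qed.

Lemma smooth_metric a b : smooth_on O (fun y => h y a b).
Proof. by case: hO. Qed.

Lemma smooth_ginv a b : smooth_on O (fun y => hi y a b).
Proof. by rewrite -metric_inv_ginv; case: hO => hs _ hu; exact: smooth_invmx. Qed.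

Lemma ginvK y a b : O y -> \sum_d hi y a d * h y d b = kronecker a b.
Proof.
rewrite -metric_inv_ginv; case: hO => _ _ hu /hu hy; have /matrixP/(_ a b) := mulVmx hy.
by rewrite !mxE => ->.
Qed.

Lemma metric_ginvK y a b : O y -> \sum_d h y a d * hi y d b = kronecker a b.
Proof.
rewrite -metric_inv_ginv; case: hO => _ _ hu /hu hy; have /matrixP/(_ a b) := mulmxV hy.
by rewrite !mxE => ->.
Qed.

Lemma ginvC y a b : O y -> hi y a b = hi y b a.
Proof.
by rewrite -metric_inv_ginv; case: hO => _ hs hu Oy;
  rewrite /metric_inv -[in LHS](hs y Oy) -trmx_inv mxE.
Qed.

(** Lowering and raising one index are stated as nested sums, the form in which
they occur inside longer contractions. *)
Lemma lower_raise y a (v : 'I_4 -> R) : O y ->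
  \sum_d h y a d * (\sum_e hi y d e * v e) = v a.
Proof.
by move=> Oy; rewrite sum_mulA; under eq_bigr do rewrite metric_ginvK//; rewrite sum_kron.
Qed.

Lemma raise_lower y a (v : 'I_4 -> R) : O y ->
  \sum_d hi y a d * (\sum_e h y d e * v e) = v a.
Proof.
by move=> Oy; rewrite sum_mulA; under eq_bigr do rewrite ginvK//; rewrite sum_kron.
Qed.

Lemma GamC y a b c : O y -> G y a b c = G y b a c.
Proof.
move=> Oy; rewrite !GamE; congr (_ * _); apply: eq_bigr => d _.
by rewrite (pd_metricC d a b Oy); ring.
Qed.

Lemma smooth_Gam a b c : smooth_on O (fun y => G y a b c).
Proof.
rewrite -christoffel_Gam /christoffel metric_inv_ginv partial_pd.
apply: smoothM => //; first exact: smooth_cst.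
apply: smooth_sum => // d; apply: smoothM => //; first exact: smooth_ginv.
apply: smoothB => //; last exact/smooth_pd/smooth_metric.
by apply: smoothD => //; exact/smooth_pd/smooth_metric.
Qed.

Local Notation Gd := (Gam_down h).

(** Koszul formula. *)
Lemma Gam_down_koszul y a b c : O y ->
  Gd y c a b = 2%:R^-1 * (pd a (fun z => h z b c) y
    + pd b (fun z => h z a c) y - pd c (fun z => h z a b) y).
Proof.
move=> Oy; rewrite Gam_downE; under eq_bigr do rewrite GamE mulrCA.
by rewrite -mulr_sumr (lower_raise _ (fun d => _ : R)).
Qed.

Lemma Gam_downC y c a b : O y -> Gd y c a b = Gd y c b a.
Proof. by move=> Oy; rewrite !Gam_downE; apply: eq_bigr => e _; rewrite GamC. Qed.

(** Metric compatibility of the connection, nabla h = 0. *)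
Lemma pd_metric y a b c : O y ->
  pd a (fun z => h z b c) y = Gd y c a b + Gd y b a c.
Proof.
by move=> Oy; rewrite !Gam_down_koszul// (pd_metricC a c b Oy); field.
Qed.

(** Compatibility with the inverse metric, from differentiating
h^{bd} h_{de} = delta^b_e. *)
Lemma pd_ginv y a b c : O y ->
  pd a (fun z => hi z b c) y =
  - (\sum_e hi y b e * G y a e c) - \sum_e hi y c e * G y a e b.
Proof.
move=> Oy; pose D d := pd a (fun z => hi z b d) y.
have DhE e : \sum_d D d * h y d e = - \sum_d hi y b d * pd a (fun z => h z d e) y.
  have : pd a (fun z => \sum_d hi z b d * h z d e) y = 0.
    rewrite -[RHS](pd_cst a (kronecker b e : R) y).
    by apply: (eq_pd _ Oo _ Oy) => z Oz; exact: ginvK.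
  have smi := smooth_ginv; have sm := smooth_metric.
  rewrite (pd_sum Oo)// => [|d]; last exact: smoothM.
  under eq_bigr do rewrite (pdM _ (smi _ _) (sm _ _) Oy).
  rewrite big_split/= => /eqP; rewrite addr_eq0 => /eqP ->; rewrite opprK.
  by apply: eq_bigr => d _; rewrite mulrC.
have -> : pd a (fun z => hi z b c) y =
    \sum_e (\sum_d D d * h y d e) * hi y e c.
  rewrite -sum_mulA; under eq_bigr do rewrite metric_ginvK//.
  by rewrite sum_kron.
have EG : \sum_e (\sum_d hi y b d * Gd y d a e) * hi y e c =
    \sum_e hi y c e * G y a e b.
  apply: eq_bigr => e _; under eq_bigr do rewrite Gam_downE.
  by rewrite raise_lower// mulrC ginvC.
have EG' : \sum_e (\sum_d hi y b d * Gd y e a d) * hi y e c =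
    \sum_d hi y b d * G y a d c.
  rewrite -sum_mulA; apply: eq_bigr => d _; congr (_ * _).
  rewrite -[RHS](raise_lower _ _ Oy); apply: eq_bigr => e _.
  by rewrite mulrC ginvC// Gam_downE.
rewrite -EG -EG' -!sumrN -!big_split/=; apply: eq_bigr => e _.
rewrite DhE; under [in LHS]eq_bigr do rewrite pd_metric//.
have [i [j [k [l sumE]]]] := @sum4 R; rewrite !sumE; ring.
Qed.

(** The commutator of covariant derivatives, evaluated on the coordinate covector
field dx^d: nabla_b (dx^d)_c is -Gamma^d_{bc}, so only first derivatives of the
Christoffel symbols and their products survive. *)
Lemma RiemE y a b c d : O y ->
  Riem h y a b c d =
    pd b (fun z => G z a c d) y - pd a (fun z => G z b c d) y
    + (\sum_e G y a c e * G y b e d) - (\sum_e G y b c e * G y a e d).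
Proof.
move=> Oy; rewrite -riemann_Riem /riemann.
set dx := fun (_ : V) (e : 'I_4) => (kronecker e d : R).
have dxE z : nabla1 h dx z = fun i j => - G z i j d.
  apply/funext => i; apply/funext => j.
  by rewrite /nabla1 /dx partial_cst sum_kron sub0r christoffel_Gam.
have dxpE i j k : pd i (fun z => nabla1 h dx z j k) y =
                  - pd i (fun z => G z j k d) y.
  rewrite -(@pdN _ O)//; last exact: smooth_Gam.
  by congr pd; apply/funext => z; rewrite dxE.
have n2 i j k : nabla2 h (nabla1 h dx) y i j k =
    - pd i (fun z => G z j k d) y + (\sum_e G y i j e * G y e k d)
    + \sum_e G y i k e * G y j e d.
  rewrite /nabla2 christoffel_Gam partial_pd dxpE dxE -!sumrN; congr (_ + _ + _).
    by apply: eq_bigr => e _; rewrite mulrN opprK.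
  by apply: eq_bigr => e _; rewrite mulrN opprK.
rewrite !n2.
have -> : \sum_e G y b a e * G y e c d = \sum_e G y a b e * G y e c d.
  by apply: eq_bigr => e _; congr (_ * _); exact: GamC.
move: (pd a _ y) (pd b _ y) (\sum_e _) (\sum_e _) (\sum_e _) => *.
by ring.
Qed.

Lemma Riem_anti y a b c d : Riem h y a b c d = - Riem h y b a c d.
Proof. by rewrite -riemann_Riem; exact/esym/opprB. Qed.

Lemma first_bianchi y a b c d : O y ->
  Riem h y a b c d + Riem h y b c a d + Riem h y c a b d = 0.
Proof.
move=> Oy; rewrite !RiemE//.
have dG i j k : pd i (fun z => G z j k d) y = pd i (fun z => G z k j d) y.
  by apply: (eq_pd _ Oo _ Oy) => z; exact: GamC.
rewrite (dG b a c) (dG a b c) (dG c a b).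
under [\sum_(e < 4) G y a c e * _]eq_bigr do rewrite (GamC a c _ Oy).
under [\sum_(e < 4) G y b c e * _]eq_bigr do rewrite (GamC b c _ Oy).
under [\sum_(e < 4) G y a b e * _]eq_bigr do rewrite (GamC a b _ Oy).
by ring.
Qed.

Lemma smooth_Gam_down a b c : smooth_on O (fun y => Gd y a b c).
Proof.
apply: (@smooth_ext _ _ Oo (fun y => \sum_e h y a e * G y b c e)) => [z _|].
  by rewrite Gam_downE.
apply: smooth_sum => // e; apply: smoothM => //; first exact: smooth_metric.
exact: smooth_Gam.
Qed.

(** Derivatives of h_{de} Gamma^e_{ac} split, by metric compatibility, so that
one of the two quadratic terms of the curvature is absorbed. The remaining
expression is written in lowered symbols, which are first derivatives of h. *)
Lemma Riem_lowE y a b c d : O y ->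
  \sum_e h y d e * Riem h y a b c e =
    pd b (fun z => Gd z d a c) y - pd a (fun z => Gd z d b c) y
    - (\sum_e Gd y e b d * G y a c e) + \sum_e Gd y e a d * G y b c e.
Proof.
move=> Oy; have sm := smooth_metric; have sG := smooth_Gam.
have dGd i j k : pd i (fun z => Gd z d j k) y =
    (\sum_e h y d e * pd i (fun z => G z j k e) y)
    + (\sum_e Gd y e i d * G y j k e) + \sum_e Gd y d i e * G y j k e.
  under eq_fun do rewrite Gam_downE.
  rewrite (pd_sum Oo)// => [|e]; last exact: smoothM.
  rewrite -!big_split/=; apply: eq_bigr => e _.
  by rewrite (pdM _ (sm _ _) (sG _ _ _) Oy) pd_metric//; ring.
have low i j k : \sum_e h y d e * (\sum_f G y i f e * G y j k f) =
    \sum_e Gd y d i e * G y j k e.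
  by rewrite sum_mulA; apply: eq_bigr => e _; rewrite Gam_downE.
rewrite !dGd -!low !opprD -!sumrN -!big_split/=; apply: eq_bigr => e _.
have [i [j [k [l sumE]]]] := @sum4 R; rewrite !RiemE// !sumE; ring.
Qed.

(** The part linear in second derivatives of h cancels after symmetrizing in
c, d because partial derivatives of h_{cd} commute; the quadratic part cancels
by the symmetry of h_{ef} Gamma^e_{ij} Gamma^f_{kl}. *)
Lemma Riem_low_anti y a b c d : O y ->
  \sum_e h y d e * Riem h y a b c e = - \sum_e h y c e * Riem h y a b d e.
Proof.
move=> Oy; apply/eqP; rewrite -addr_eq0; apply/eqP; rewrite !Riem_lowE//.
have sGd := smooth_Gam_down.
have hab : pd b (fun z => Gd z d a c) y + pd b (fun z => Gd z c a d) y =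
           pd a (fun z => Gd z d b c) y + pd a (fun z => Gd z c b d) y.
  rewrite -!(@pdD _ O)//.
  transitivity (pd b (pd a (fun z => h z c d)) y).
    by apply: (eq_pd _ Oo _ Oy) => z Oz; rewrite pd_metric.
  rewrite (pdC Oo _ _ (smooth_metric c d) Oy).
  by apply: (eq_pd _ Oo _ Oy) => z Oz; rewrite pd_metric.
have q i j k l : \sum_e Gd y e i j * G y k l e = \sum_e Gd y e k l * G y i j e.
  have sE m n p r : \sum_e Gd y e m n * G y p r e =
       \sum_e G y m n e * (\sum_f h y e f * G y p r f).
    rewrite sum_mulA; apply: eq_bigr => e _; rewrite Gam_downE; congr (_ * _).
    by apply: eq_bigr => f _; rewrite mulrC metric_onC.
  by rewrite sE; apply: eq_bigr => e _; rewrite Gam_downE mulrC.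
rewrite (q b c) (q a c).
set A := pd b _ y in hab *; set B := pd b _ y in hab *.
set A' := pd a _ y in hab *; set B' := pd a _ y in hab *.
have -> : A = A' + B' - B by rewrite -hab addrK.
by ring.
Qed.

End LeviCivita.

(** * Four-dimensional tensor algebra *)

Section WeylAlgebra.
Variable R : realType.
Implicit Types a b c d e : 'I_4.

(** The cyclic identities for the rotations of (a, b, c, d) starting at a and b,
minus those starting at c and d. *)
Lemma pair_symmetry (T : 'I_4 -> 'I_4 -> 'I_4 -> 'I_4 -> R) :
  (forall a b c d, T a b c d = - T b a c d) ->
  (forall a b c d, T a b c d = - T a b d c) ->
  (forall a b c d, T a b c d + T b c a d + T c a b d = 0) ->
  forall a b c d, T a b c d = T c d a b.
Proof.
move=> T12 T34 cyc a b c d.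
have := cyc a b c d; have := cyc b c d a; have := cyc c d a b; have := cyc d a b c.
rewrite (T34 b c d a) (T34 c d b a) (T34 d a c b) (T34 a b d c).
rewrite (T12 a c d b) (T34 c a d b) (T12 b d a c) (T34 d b a c).
lra.
Qed.

(** Completes two distinct indices to a list of all four, so that identities
invariant under renaming of the axes need only one case. *)
Lemma sum4_from a b : a != b ->
  exists c d, forall F : 'I_4 -> R, \sum_x F x = F a + F b + F c + F d.
Proof.
move=> ab; pose i1 : 'I_4 := lift ord0 ord0.
pose b' := tperm ord0 a b; have b'0 : b' != ord0.
  by apply: contraNneq ab => b0; rewrite -(tpermK ord0 a b) -/b' b0 tpermL.
pose s x := tperm ord0 a (tperm i1 b' x).
have s0 : s ord0 = a by rewrite /s (tpermD _ b'0)// tpermL.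
have s1 : s i1 = b by rewrite /s tpermL tpermK.
exists (s (lift ord0 (lift ord0 ord0))),
  (s (lift ord0 (lift ord0 (lift ord0 ord0)))) => F.
rewrite (reindex_inj (h := s)); last exact: inj_comp perm_inj perm_inj.
by rewrite !big_ord_recl big_ord0/= addr0 !addrA s0 s1.
Qed.

(** The contraction X_{da}^{mp} X_{mp}^{ea} of the square of an endomorphism X of
bivectors. *)
Definition square_trace (X : 'I_4 -> 'I_4 -> 'I_4 -> 'I_4 -> R) d e : R :=
  \sum_a \sum_m \sum_p X d a m p * X m p e a.

Section TracelessBivectorMap.
Variable X : 'I_4 -> 'I_4 -> 'I_4 -> 'I_4 -> R.
Hypothesis X12 : forall a b c d, X a b c d = - X b a c d.
Hypothesis X34 : forall a b c d, X a b c d = - X a b d c.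
Hypothesis X_traceless : forall a c, \sum_b X a b c b = 0.

Lemma anti12_diag a c d : X a a c d = 0.
Proof. by have := X12 a a c d; lra. Qed.

Lemma anti34_diag a b c : X a b c c = 0.
Proof. by have := X34 a b c c; lra. Qed.

Local Notation S := (square_trace X).

(** In dimension four the vanishing of X_{ab}^{cb} identifies, up to sign, the
entry of X at a pair (I, J) of index pairs with its entry at the pair of
complements (J', I'): X is self-adjoint for the wedge pairing of bivectors.
So is its square Y, and this makes the two terms of the off-diagonal
contraction Y_{da}^{ea} cancel and the diagonal contractions agree. *)
Lemma square_trace_aux a b : a != b -> S a b = 0 /\ S a a = S b b.
Proof.
move=> /sum4_from[c [d sumE]].
(* Rewriting with [lo] and [up] orders both index pairs, which leaves 36 unknowns. *)
have lo := (X12 b a, X12 c a, X12 d a, X12 c b, X12 d b, X12 d c, anti12_diag).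
have up := (fun i j => X34 i j b a, fun i j => X34 i j c a, fun i j => X34 i j d a,
  fun i j => X34 i j c b, fun i j => X34 i j d b, fun i j => X34 i j d c, anti34_diag).
have tr i j : X i a j a + X i b j b + X i c j c + X i d j d = 0.
  by have := X_traceless i j; rewrite sumE.
(* The off-diagonal traces: entries at (I, J) against entries at the complements. *)
have e1 : X b c a b = X c d a d by have := tr c a; rewrite !lo !up; lra.
have e2 : X a c a b = - X c d b d by have := tr c b; rewrite !lo !up; lra.
have e3 : X a c a d = - X b c b d by have := tr c d; rewrite !lo !up; lra.
have e4 : X b d a b = - X c d a c by have := tr d a; rewrite !lo !up; lra.
have e5 : X a d a b = X c d b c by have := tr d b; rewrite !lo !up; lra.
have e6 : X a d a c = - X b d b c by have := tr d c; rewrite !lo !up; lra.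
have e7 : X a c b c = - X a d b d by have := tr a b; rewrite !lo !up; lra.
have e8 : X a b b c = X a d c d by have := tr a c; rewrite !lo !up; lra.
have e9 : X a b b d = - X a c c d by have := tr a d; rewrite !lo !up; lra.
have e10 : X b c a c = - X b d a d by have := tr b a; rewrite !lo !up; lra.
have e11 : X a b a c = - X b d c d by have := tr b c; rewrite !lo !up; lra.
have e12 : X a b a d = X b c c d by have := tr b d; rewrite !lo !up; lra.
(* The diagonal traces identify complementary diagonal entries. *)
have [dab dac dad dbc] : [/\ X a b a b = X c d c d, X a c a c = X b d b d,
    X a d a d = X b c b c & X b c b c = - X c d c d - X b d b d].
  have := tr a a; have := tr b b; have := tr c c; have := tr d d.
  by rewrite !lo !up => *; split; lra.
rewrite /square_trace !sumE !lo !up.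
by rewrite !(e1, e2, e3, e4, e5, e6) !(e7, e8, e9, e10, e11, e12)
  !(dab, dac, dad) !dbc; split; ring.
Qed.

Lemma square_traceE d e : S d e = 4%:R^-1 * (\sum_f S f f) * kronecker d e.
Proof.
have SE f : S f f = S d d.
  by have [->//|/square_trace_aux[]] := eqVneq f d.
rewrite (eq_bigr (fun=> S d d))// sumr_const card_ord
  -[S d d *+ _]mulr_natl mulKf ?pnatr_eq0//.
rewrite /kronecker; have [<-|/square_trace_aux[-> _]] := eqVneq d e.
  by rewrite mulr1.
by rewrite mulr0.
Qed.

End TracelessBivectorMap.
End WeylAlgebra.

(** * The Weyl tensor *)

Section Sealed.
Variables (R : realType) (h : 'rV[R]_4 -> 'M[R]_4).
Local Notation V := 'rV[R]_4.

Definition Ric : V -> 'I_4 -> 'I_4 -> R := locked (ricci h).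
Definition Scal : V -> R := locked (scalar_curvature h).
Definition Sch : V -> 'I_4 -> 'I_4 -> R := locked (schouten h).
Definition Sch_up : V -> 'I_4 -> 'I_4 -> R := locked (schouten_up h).
Definition Weyl : V -> 'I_4 -> 'I_4 -> 'I_4 -> 'I_4 -> R := locked (weyl h).

(** The mixed Weyl tensor C_{ab}^{cd}, as a map on bivectors. *)
Definition Weyl_mixed : V -> 'I_4 -> 'I_4 -> 'I_4 -> 'I_4 -> R :=
  locked (fun y a b c d => \sum_e ginv h y c e * Weyl y a b e d).

Lemma ricci_Ric : ricci h = Ric. Proof. by rewrite /Ric -lock. Qed.
Lemma scalar_curvature_Scal : scalar_curvature h = Scal.
Proof. by rewrite /Scal -lock. Qed.
Lemma schouten_Sch : schouten h = Sch. Proof. by rewrite /Sch -lock. Qed.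
Lemma schouten_up_Sch_up : schouten_up h = Sch_up. Proof. by rewrite /Sch_up -lock. Qed.
Lemma weyl_Weyl : weyl h = Weyl. Proof. by rewrite /Weyl -lock. Qed.

Lemma RicE y a c : Ric y a c = \sum_b Riem h y a b c b.
Proof. by rewrite -ricci_Ric /ricci riemann_Riem. Qed.

Lemma ScalE y : Scal y = \sum_a \sum_b ginv h y a b * Ric y a b.
Proof. by rewrite -scalar_curvature_Scal /scalar_curvature metric_inv_ginv ricci_Ric. Qed.

Lemma SchE y a b : Sch y a b = 2%:R^-1 * (Ric y a b - 6%:R^-1 * Scal y * h y a b).
Proof. by rewrite -schouten_Sch /schouten ricci_Ric scalar_curvature_Scal. Qed.

Lemma Sch_upE y d b : Sch_up y d b = \sum_e ginv h y d e * Sch y e b.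
Proof. by rewrite -schouten_up_Sch_up /schouten_up metric_inv_ginv schouten_Sch. Qed.

Lemma WeylE y a b c d : Weyl y a b c d =
  Riem h y a b c d - (Sch_up y d b * h y a c - Sch_up y d a * h y b c)
  - (kronecker d b * Sch y a c - kronecker d a * Sch y b c).
Proof.
rewrite -weyl_Weyl /weyl riemann_Riem schouten_up_Sch_up schouten_Sch /alt.
by field.
Qed.

Lemma Weyl_mixedE y a b c d :
  Weyl_mixed y a b c d = \sum_e ginv h y c e * Weyl y a b e d.
Proof. by rewrite /Weyl_mixed -lock. Qed.

End Sealed.

Section WeylSymmetries.
Variable R : realType.
Local Notation V := 'rV[R]_4.
Variables (O : set V) (h : V -> 'M[R]_4).
Hypothesis Oo : open O.
Hypothesis hO : metric_on O h.
Implicit Types (a b c d e : 'I_4) (y : V).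
Local Notation G := (Gam h).
Local Notation hi := (ginv h).
Local Notation L := (Sch h).
Local Notation W := (Weyl h).
Local Notation X := (Weyl_mixed h).

Lemma smooth_Riem a b c d : smooth_on O (fun y => Riem h y a b c d).
Proof.
have sG := smooth_Gam Oo hO.
have sGG i j k l m n : smooth_on O (fun y => G y i j k * G y l m n).
  exact: smoothM.
apply: (smooth_ext Oo (f := fun y => pd b (fun z => G z a c d) y
    - pd a (fun z => G z b c d) y + (\sum_e G y a c e * G y b e d)
    - (\sum_e G y b c e * G y a e d))).
  by move=> y Oy; rewrite (RiemE Oo hO).
apply: smoothB => //; last exact: smooth_sum.
apply: smoothD => //; last exact: smooth_sum.
by apply: smoothB => //; exact: smooth_pd.
Qed.

Lemma smooth_Ric a b : smooth_on O (fun y => Ric h y a b).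
Proof.
apply: (smooth_ext Oo (f := fun y => \sum_e Riem h y a e b e)) => [y _|].
  by rewrite RicE.
by apply: smooth_sum => // e; exact: smooth_Riem.
Qed.

Lemma smooth_Sch a b : smooth_on O (fun y => L y a b).
Proof.
have sS : smooth_on O (Scal h).
  apply: (smooth_ext Oo (f := fun y => \sum_a \sum_b hi y a b * Ric h y a b)).
    by move=> y _; rewrite ScalE.
  apply: smooth_sum => // i; apply: smooth_sum => // j; apply: smoothM => //.
    exact: smooth_ginv hO _ _.
  exact: smooth_Ric.
apply: (smooth_ext Oo (f := fun y =>
    2%:R^-1 * (Ric h y a b - 6%:R^-1 * Scal h y * h y a b))) => [y _|].
  by rewrite SchE.
have shS := smoothM Oo (smoothM Oo (@smooth_cst _ O 6%:R^-1) sS) (smooth_metric hO a b).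
exact: (smoothM Oo (@smooth_cst _ O _) (smoothB Oo (smooth_Ric a b) shS)).
Qed.

Variable y : V.
Hypothesis Oy : O y.

Local Notation hC := (metric_onC hO).
Local Notation hiC := (ginvC hO).

(** Contraction of the antisymmetric pair R_{abcd} = -R_{abdc} with the symmetric
inverse metric. *)
Lemma Riem_trace a b : \sum_c Riem h y a b c c = 0.
Proof.
pose D c d := \sum_e h y d e * Riem h y a b c e.
have DN c d : D c d = - D d c by rewrite /D (Riem_low_anti Oo hO _ _ _ _ Oy).
have E : \sum_c Riem h y a b c c = \sum_c \sum_d hi y c d * D c d.
  by apply: eq_bigr => c _; rewrite (raise_lower hO).
have : \sum_c Riem h y a b c c = - \sum_c Riem h y a b c c.
  rewrite {1}E exchange_big E/= -sumrN; apply: eq_bigr => c _.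
  by rewrite -sumrN; apply: eq_bigr => d _; rewrite hiC// DN mulrN.
by lra.
Qed.

(** The trace of the first Bianchi identity; the third term drops out by
[Riem_trace]. *)
Lemma RicC a b : Ric h y a b = Ric h y b a.
Proof.
rewrite !RicE; apply/eqP; rewrite -subr_eq0 -[X in _ == X](Riem_trace a b).
rewrite eq_sym -subr_eq0 opprB -sumrB -big_split/=; apply/eqP/big1 => c _.
have := first_bianchi Oo hO b a c c Oy.
rewrite (Riem_anti h y b a) (Riem_anti h y c b).
by lra.
Qed.

Lemma SchC a b : L y a b = L y b a.
Proof. by rewrite !SchE RicC hC. Qed.

Lemma lower_Sch_up a b : \sum_e h y a e * Sch_up h y e b = L y a b.
Proof. by under eq_bigr do rewrite Sch_upE; rewrite (lower_raise hO). Qed.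

Lemma Weyl_anti a b c d : W y a b c d = - W y b a c d.
Proof. by rewrite !WeylE (Riem_anti h y a b); ring. Qed.

(** The numerical factors in the Schouten tensor are the ones that make this
trace vanish in dimension four. *)
Lemma Weyl_traceless a c : \sum_b W y a b c b = 0.
Proof.
have trL : \sum_b Sch_up h y b b = 6%:R^-1 * Scal h y.
  under eq_bigr => b _.
    rewrite Sch_upE; under eq_bigr do rewrite SchE.
    over.
  have trh : \sum_b \sum_e hi y b e * h y e b = 4.
    by under eq_bigr do rewrite (ginvK hO)//; exact: kronecker_trace.
  set s := Scal h y.
  have -> : \sum_b \sum_e hi y b e *
      (2%:R^-1 * (Ric h y e b - 6%:R^-1 * s * h y e b)) =
      2%:R^-1 * (\sum_b \sum_e hi y b e * Ric h y b e)
      - 2%:R^-1 * (6%:R^-1 * s) * \sum_b \sum_e hi y b e * h y e b.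
    rewrite !mulr_sumr -sumrB; apply: eq_bigr => b _.
    rewrite !mulr_sumr -sumrB; apply: eq_bigr => e _.
    by rewrite (RicC e b); ring.
  rewrite -ScalE -/s.
  by rewrite trh; field.
have tr1 : \sum_b Sch_up h y b a * h y b c = L y c a.
  by rewrite -lower_Sch_up; apply: eq_bigr => b _; rewrite mulrC hC.
under eq_bigr do rewrite WeylE.
rewrite !sumrB -RicE -!mulr_suml trL tr1 kronecker_trace sum_kron (SchC c a).
by rewrite SchE; field.
Qed.

(** C_{abcd}, in the form [\sum_e h y d e * _] of the other lowering lemmas. *)
Definition Weyl_low a b c d : R := \sum_e h y d e * W y a b c e.

Lemma Weyl_lowE a b c d : Weyl_low a b c d =
  (\sum_e h y d e * Riem h y a b c e) - (L y d b * h y a c - L y d a * h y b c)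
  - (h y d b * L y a c - h y d a * L y b c).
Proof.
rewrite /Weyl_low -(lower_Sch_up d b) -(lower_Sch_up d a).
have sk f : h y d f = \sum_e h y d e * kronecker e f by rewrite sum_kron.
rewrite (sk b) (sk a) !mulr_suml -!sumrB; apply: eq_bigr => e _.
by rewrite WeylE; ring.
Qed.

Lemma Weyl_low_anti12 a b c d : Weyl_low a b c d = - Weyl_low b a c d.
Proof.
by rewrite -sumrN; apply: eq_bigr => e _; rewrite Weyl_anti mulrN.
Qed.

Lemma Weyl_low_anti34 a b c d : Weyl_low a b c d = - Weyl_low a b d c.
Proof.
rewrite !Weyl_lowE (Riem_low_anti Oo hO _ _ _ _ Oy).
rewrite (SchC d b) (SchC d a) (SchC c b) (SchC c a).
rewrite (hC d b)// (hC d a)// (hC c b)// (hC c a)//.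
by ring.
Qed.

Lemma Weyl_low_cyclic a b c d :
  Weyl_low a b c d + Weyl_low b c a d + Weyl_low c a b d = 0.
Proof.
have cyc : \sum_e h y d e * Riem h y a b c e = - (\sum_e h y d e * Riem h y b c a e)
    - \sum_e h y d e * Riem h y c a b e.
  rewrite -sumrN -sumrB; apply: eq_bigr => e _.
  have /eqP := first_bianchi Oo hO a b c e Oy.
  by rewrite -addrA addr_eq0 => /eqP ->; ring.
rewrite !Weyl_lowE cyc (SchC b a) (SchC c b) (SchC c a).
rewrite (hC b a)// (hC c b)// (hC c a)//.
by ring.
Qed.

Lemma Weyl_low_pair a b c d : Weyl_low a b c d = Weyl_low c d a b.
Proof.
apply: pair_symmetry => *; [exact: Weyl_low_anti12|exact: Weyl_low_anti34|].
exact: Weyl_low_cyclic.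
Qed.

Lemma raise_Weyl_low a b c d : W y a b c d = \sum_e hi y d e * Weyl_low a b c e.
Proof. by rewrite (raise_lower hO). Qed.

Lemma Weyl_mixed_anti12 a b c d : X y a b c d = - X y b a c d.
Proof.
rewrite !Weyl_mixedE -sumrN; apply: eq_bigr => e _.
by rewrite Weyl_anti mulrN.
Qed.

Lemma Weyl_mixed_anti34 a b c d : X y a b c d = - X y a b d c.
Proof.
have XE i j : X y a b i j = \sum_e \sum_f hi y i e * (hi y j f * Weyl_low a b e f).
  rewrite Weyl_mixedE; apply: eq_bigr => e _.
  by rewrite raise_Weyl_low mulr_sumr.
rewrite !XE exchange_big -sumrN; apply: eq_bigr => e _/=.
rewrite -sumrN; apply: eq_bigr => f _.
by rewrite Weyl_low_anti34; ring.
Qed.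

Lemma Weyl_mixed_traceless a c : \sum_b X y a b c b = 0.
Proof.
under eq_bigr do rewrite Weyl_mixedE.
rewrite exchange_big/= big1// => e _.
by rewrite -mulr_sumr Weyl_traceless mulr0.
Qed.

Lemma Weyl_up3E a b c d :
  weyl_up3 h y a b c d = \sum_e hi y b e * X y a e c d.
Proof.
rewrite /weyl_up3 metric_inv_ginv weyl_Weyl; apply: eq_bigr => e _.
by rewrite Weyl_mixedE mulr_sumr; apply: eq_bigr => f _; rewrite mulrA.
Qed.

(** Pair symmetry turns C_{abcd} into C_{cdab}, so that raising its last two
indices pairs the mixed tensor with itself as an endomorphism of bivectors. *)
Lemma Weyl_squareE : weyl_square h y = \sum_f square_trace (X y) f f.
Proof.
have downE a b c d : weyl_down h y a b c d = Weyl_low c d a b.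
  rewrite -Weyl_low_pair /weyl_down weyl_Weyl; apply: eq_bigr => e _.
  by rewrite mulrC hC.
have upE a b c d : weyl_up h y a b c d =
    \sum_e hi y a e * (\sum_f hi y b f * X y e f c d).
  rewrite /weyl_up metric_inv_ginv; apply: eq_bigr => e _.
  by rewrite Weyl_up3E.
rewrite /weyl_square exchange_sum_pairs; apply: eq_bigr => c _.
rewrite /square_trace; apply: eq_bigr => d _.
transitivity (\sum_e \sum_f (\sum_a hi y e a * W y c d a f) * X y e f c d);
  last by do 2 apply: eq_bigr => ? _; congr (_ * _); rewrite Weyl_mixedE.
transitivity (\sum_a \sum_e hi y a e * \sum_f W y c d a f * X y e f c d).
  apply: eq_bigr => a _.
  under eq_bigr do rewrite downE upE mulr_sumr.
  rewrite exchange_big; apply: eq_bigr => e _/=.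
  under eq_bigr do rewrite mulrCA.
  rewrite -mulr_sumr sum_mulA; congr (_ * _); apply: eq_bigr => f _.
  congr (_ * _); rewrite raise_Weyl_low; apply: eq_bigr => b _.
  by rewrite mulrC hiC.
rewrite exchange_big; apply: eq_bigr => e _/=.
by rewrite sum_mulA; under eq_bigr do under eq_bigr do rewrite hiC//.
Qed.

(** The four-dimensional identity [square_traceE] in the index positions of
Lambda; the sign comes from C_{mp}^{ef} = -C_{mp}^{fe}. *)
Lemma Weyl_contraction d (u : 'I_4 -> R) :
  \sum_a \sum_m \sum_p weyl_up3 h y d a m p * (\sum_f W y m p a f * u f) =
  - 4%:R^-1 * weyl_square h y * u d.
Proof.
have trE e f : square_trace (X y) e f =
    4%:R^-1 * weyl_square h y * kronecker e f.
  rewrite Weyl_squareE; apply: square_traceE.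
  - exact: Weyl_mixed_anti12.
  - exact: Weyl_mixed_anti34.
  - exact: Weyl_mixed_traceless.
transitivity (- \sum_f square_trace (X y) d f * u f); last first.
  under eq_bigr do rewrite trE -!mulrA.
  by rewrite -!mulr_sumr sum_kron; ring.
transitivity (\sum_e \sum_m \sum_p \sum_f X y d e m p * X y m p e f * u f); last first.
  transitivity (- \sum_e \sum_m \sum_p \sum_f X y d e m p * X y m p f e * u f).
    rewrite -sumrN; apply: eq_bigr => e _; rewrite -sumrN; apply: eq_bigr => m _.
    rewrite -sumrN; apply: eq_bigr => p _; rewrite -sumrN; apply: eq_bigr => f _.
    by rewrite (Weyl_mixed_anti34 m p e f); ring.
  congr (- _); under [RHS]eq_bigr do rewrite mulr_suml.
  rewrite [RHS]exchange_big; apply: eq_bigr => e _/=.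
  under [RHS]eq_bigr do rewrite mulr_suml.
  rewrite [RHS]exchange_big; apply: eq_bigr => m _/=.
  under [RHS]eq_bigr do rewrite mulr_suml.
  by rewrite [RHS]exchange_big.
rewrite exchange_big [RHS]exchange_big; apply: eq_bigr => m _/=.
rewrite exchange_big [RHS]exchange_big; apply: eq_bigr => p _/=.
transitivity (\sum_a \sum_e X y d e m p * (hi y e a * \sum_f W y m p a f * u f)).
  apply: eq_bigr => a _; rewrite Weyl_up3E mulr_suml; apply: eq_bigr => e _.
  by rewrite hiC//; ring.
rewrite exchange_big; apply: eq_bigr => e _/=.
rewrite -mulr_sumr sum_mulA mulr_sumr; apply: eq_bigr => f _.
by rewrite [X in _ * X * _]Weyl_mixedE mulrA.
Qed.

End WeylSymmetries.

(** * Conformal change of metric *)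

(** [u] stands for the components of the gradient U of the logarithm of the
conformal factor; the terms below are built from [u] and the base metric [h]. *)
Section ConformalTerms.
Variables (R : realType) (h : 'rV[R]_4 -> 'M[R]_4) (u : 'I_4 -> 'rV[R]_4 -> R).
Local Notation V := 'rV[R]_4.
Implicit Types (a b c d e : 'I_4) (y : V).

Definition u_up : V -> 'I_4 -> R :=
  locked (fun y c => \sum_d ginv h y c d * u d y).
Definition u_sq : V -> R := locked (fun y => \sum_c u c y * u_up y c).
Definition hess : V -> 'I_4 -> 'I_4 -> R :=
  locked (fun y a b => pd a (u b) y - \sum_d Gam h y a b d * u d y).
(** S^c_{ab}, with the upper index last as in [christoffel]. *)
Definition Gam_shift y a b c : R :=
  kronecker c a * u b y + kronecker c b * u a y - h y a b * u_up y c.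
(** P_{ab}, the change of the Schouten tensor. *)
Definition Sch_shift : V -> 'I_4 -> 'I_4 -> R :=
  locked (fun y a b => u a y * u b y - hess y a b - 2%:R^-1 * u_sq y * h y a b).

Lemma u_upE y c : u_up y c = \sum_d ginv h y c d * u d y.
Proof. by rewrite /u_up -lock. Qed.
Lemma u_sqE y : u_sq y = \sum_c u c y * u_up y c.
Proof. by rewrite /u_sq -lock. Qed.
Lemma hessE y a b : hess y a b = pd a (u b) y - \sum_d Gam h y a b d * u d y.
Proof. by rewrite /hess -lock. Qed.
Lemma Sch_shiftE y a b :
  Sch_shift y a b = u a y * u b y - hess y a b - 2%:R^-1 * u_sq y * h y a b.
Proof. by rewrite /Sch_shift -lock. Qed.

End ConformalTerms.

Section ConformalChange.
Variable R : realType.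
Local Notation V := 'rV[R]_4.
Variables (O : set V) (h h' : V -> 'M[R]_4).
Variables (th : V -> R) (u : 'I_4 -> V -> R).
Hypothesis Oo : open O.
Hypothesis hO : metric_on O h.
Hypothesis hO' : metric_on O h'.
Hypothesis th_neq0 : forall y, O y -> th y != 0.
Hypothesis th_smooth : smooth_on O th.
Hypothesis h'E : forall y, O y -> h' y = th y ^+ 2 *: h y.
Hypothesis u_smooth : forall a, smooth_on O (u a).
Hypothesis pd_th : forall a y, O y -> pd a th y = th y * u a y.
Hypothesis u_closed : forall a b y, O y -> pd a (u b) y = pd b (u a) y.
Implicit Types (a b c d e : 'I_4) (y : V).

Local Notation G := (Gam h).
Local Notation Gd := (Gam_down h).
Local Notation hi := (ginv h).
Local Notation U := (u_up h u).
Local Notation Q := (u_sq h u).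
Local Notation N := (hess h u).
Local Notation S := (Gam_shift h u).
Local Notation P := (Sch_shift h u).
Local Notation hC := (metric_onC hO).
Local Notation hiC := (ginvC hO).

Lemma metric_conf y a b : O y -> h' y a b = th y ^+ 2 * h y a b.
Proof. by move=> Oy; rewrite h'E// mxE. Qed.

Lemma ginv_conf y a b : O y -> ginv h' y a b = (th y ^+ 2)^-1 * hi y a b.
Proof.
move=> Oy; rewrite -metric_inv_ginv /metric_inv h'E//.
have : h' y \in unitmx by case: hO' => _ _; exact.
by rewrite h'E// => ?; rewrite invmxZ// mxE.
Qed.

Lemma pd_metric_conf y a b c : O y -> pd a (fun z => h' z b c) y =
  th y ^+ 2 * (2%:R * u a y * h y b c + pd a (fun z => h z b c) y).
Proof.
move=> Oy; have sh := smooth_metric hO b c.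
rewrite (eq_pd a Oo (g := fun z => th z * (th z * h z b c)) _ Oy); last first.
  by move=> z Oz; rewrite metric_conf// expr2 mulrA.
rewrite (pdM _ th_smooth (smoothM Oo th_smooth sh) Oy) (pdM _ th_smooth sh Oy).
by rewrite pd_th//; ring.
Qed.

Lemma Gam_conf y a b c : O y -> Gam h' y a b c = G y a b c + S y a b c.
Proof.
move=> Oy; have t0 : th y ^+ 2 != 0 by rewrite expf_neq0 ?th_neq0.
have kE i : \sum_d hi y c d * h y i d = kronecker c i.
  by rewrite -(ginvK hO c i Oy); apply: eq_bigr => d _; rewrite (hC i d).
rewrite /Gam_shift -(kE a) -(kE b) u_upE !GamE.
rewrite [h y a b * _]mulr_sumr ![_ * u _ _]mulr_suml !mulr_sumr.
rewrite -big_split -sumrB -big_split/=; apply: eq_bigr => d _.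
by rewrite ginv_conf// !pd_metric_conf//; field; exact: th_neq0.
Qed.

Lemma lower_u_up y a : O y -> \sum_d h y a d * U y d = u a y.
Proof. by move=> Oy; under eq_bigr do rewrite u_upE; rewrite (lower_raise hO). Qed.

Lemma smooth_u_up c : smooth_on O (fun y => U y c).
Proof.
apply: (smooth_ext Oo (f := fun y => \sum_d hi y c d * u d y)) => [y _|].
  by rewrite u_upE.
apply: (smooth_sum Oo) => d.
exact: (smoothM Oo (smooth_ginv Oo hO c d) (u_smooth d)).
Qed.

Lemma sum_Gam_u y a b : \sum_d G y a b d * u d y = pd a (u b) y - N y a b.
Proof. by rewrite hessE opprB addrC subrK. Qed.

(** The Hessian is symmetric because U is closed and the connection is
torsion-free. *)
Lemma hessC y a b : O y -> N y a b = N y b a.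
Proof.
move=> Oy; rewrite !hessE u_closed//; congr (_ - _).
by apply: eq_bigr => d _; rewrite (GamC Oo hO).
Qed.

Lemma Sch_shiftC y a b : O y -> P y a b = P y b a.
Proof. by move=> Oy; rewrite !Sch_shiftE hessC// hC//; ring. Qed.

(** nabla_a U^c = h^{ce} nabla_a U_e, by metric compatibility. *)
Lemma pd_u_up y a c : O y ->
  pd a (fun z => U z c) y = (\sum_e hi y c e * N y a e) - \sum_e G y a e c * U y e.
Proof.
move=> Oy; have smi := smooth_ginv Oo hO.
rewrite (eq_pd a Oo (g := fun z => \sum_d hi z c d * u d z) _ Oy); last first.
  by move=> z _; rewrite u_upE.
rewrite (pd_sum Oo)// => [|d]; last exact: (smoothM Oo (smi c d) (u_smooth d)).
under eq_bigr => d _ do rewrite (pdM _ (smi c d) (u_smooth d) Oy).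
rewrite big_split/=.
have -> : \sum_d u d y * pd a (fun z => hi z c d) y =
    - (\sum_e hi y c e * \sum_d G y a e d * u d y) - \sum_e G y a e c * U y e.
  transitivity (\sum_d (- ((\sum_e hi y c e * G y a e d) * u d y)
      - \sum_e G y a e c * (hi y e d * u d y))).
    apply: eq_bigr => d _; rewrite (pd_ginv Oo hO)// mulrBr mulrN mulrC.
    congr (_ - _); rewrite mulr_sumr; apply: eq_bigr => e _.
    by rewrite (hiC d e)//; ring.
  rewrite sumrB sumrN -sum_mulA; congr (_ - _); rewrite exchange_big.
  by apply: eq_bigr => e _/=; rewrite -mulr_sumr u_upE.
rewrite addrA -sumrB; congr (_ - _); apply: eq_bigr => e _.
by rewrite sum_Gam_u; ring.
Qed.

Lemma pd_Gam_shift y a b c d : O y ->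
  pd a (fun z => S z b c d) y =
    kronecker d b * pd a (u c) y + kronecker d c * pd a (u b) y
    - (Gd y c a b + Gd y b a c) * U y d
    - h y b c * ((\sum_e hi y d e * N y a e) - \sum_e G y a e d * U y e).
Proof.
move=> Oy; have sU := smooth_u_up d; have sh := smooth_metric hO b c.
have sk (k : R) i : smooth_on O (fun z => k * u i z).
  exact: (smoothM Oo (@smooth_cst _ O k) (u_smooth i)).
rewrite /Gam_shift (pdB _ (smoothD Oo (sk _ c) (sk _ b)) (smoothM Oo sh sU) Oy).
rewrite (pdD _ (sk _ c) (sk _ b) Oy) !(pdZ _ _ (u_smooth _) Oy).
by rewrite (pdM _ sh sU Oy) pd_u_up// (pd_metric Oo hO)//; ring.
Qed.

Lemma sum_shift_l y a c (v : 'I_4 -> R) :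
  \sum_e S y a c e * v e =
  v a * u c y + v c * u a y - h y a c * \sum_e U y e * v e.
Proof.
rewrite -(sum_kron_col v a) -(sum_kron_col v c) !mulr_suml mulr_sumr.
by rewrite -big_split -sumrB/=; apply: eq_bigr => e _; rewrite /Gam_shift; ring.
Qed.

Lemma sum_shift_r y b d (w : 'I_4 -> R) :
  \sum_e w e * S y b e d =
  kronecker d b * (\sum_e w e * u e y) + w d * u b y
  - (\sum_e h y b e * w e) * U y d.
Proof.
rewrite -(sum_kron_row w d) !mulr_suml mulr_sumr.
by rewrite -big_split -sumrB/=; apply: eq_bigr => e _; rewrite /Gam_shift; ring.
Qed.

(** P^d_b. *)
Definition Sch_shift_up y d b : R := \sum_e hi y d e * P y e b.

Lemma Sch_shift_upE y d b : O y -> Sch_shift_up y d b =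
  U y d * u b y - (\sum_e hi y d e * N y b e) - 2%:R^-1 * Q y * kronecker d b.
Proof.
move=> Oy; rewrite /Sch_shift_up -(ginvK hO d b Oy) u_upE.
rewrite mulr_suml mulr_sumr -!sumrB; apply: eq_bigr => e _.
by rewrite Sch_shiftE (hessC e b)//; ring.
Qed.

(** Substitution of Gamma + S into [RiemE]: the terms in Gamma S complete the
derivatives of U to covariant ones, and the terms in S S supply the quadratic
part of P. *)
Lemma Riem_conf y a b c d : O y ->
  Riem h' y a b c d = Riem h y a b c d
    + Sch_shift_up y d b * h y a c - Sch_shift_up y d a * h y b c
    + kronecker d b * P y a c - kronecker d a * P y b c.
Proof.
move=> Oy; rewrite (RiemE Oo hO')// (RiemE Oo hO)//.
have sG := smooth_Gam Oo hO.
have sS i j k : smooth_on O (fun z => S z i j k).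
  have sk (r : R) l : smooth_on O (fun z => r * u l z).
    exact: (smoothM Oo (@smooth_cst _ O r) (u_smooth l)).
  exact: (smoothB Oo (smoothD Oo (sk _ _) (sk _ _))
    (smoothM Oo (smooth_metric hO _ _) (smooth_u_up _))).
have dG' i j k : pd i (fun z => Gam h' z j k d) y =
    pd i (fun z => G z j k d) y + pd i (fun z => S z j k d) y.
  rewrite -(pdD _ (sG _ _ _) (sS _ _ _) Oy).
  by apply: (eq_pd _ Oo _ Oy) => z Oz; rewrite Gam_conf.
have quad i j : \sum_e Gam h' y i c e * Gam h' y j e d =
    (\sum_e G y i c e * G y j e d) + (\sum_e G y i c e * S y j e d)
    + \sum_e S y i c e * (G y j e d + S y j e d).
  rewrite -!big_split/=; apply: eq_bigr => e _.
  by rewrite !Gam_conf//; ring.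
rewrite !dG' !quad !pd_Gam_shift// !sum_shift_l !sum_shift_r.
have UGS i : \sum_e U y e * (G y i e d + S y i e d) =
    (\sum_e G y i e d * U y e) + kronecker d i * Q y.
  under eq_bigr do rewrite mulrDr; rewrite big_split/= sum_shift_r.
  rewrite lower_u_up// u_sqE.
  under [X in _ * X + _ - _]eq_bigr do rewrite mulrC.
  under [X in X + _ = _]eq_bigr do rewrite mulrC.
  by ring.
rewrite !UGS -!Gam_downE !sum_Gam_u !Sch_shift_upE// !Sch_shiftE /Gam_shift.
rewrite (GamC Oo hO b a)// (Gam_downC Oo hO a b c)// (Gam_downC Oo hO c b a)//.
rewrite (hC b a)// (hC b c)// (u_closed b a)//.
by field.
Qed.

Lemma Ric_conf y a c : O y -> Ric h' y a c =
  Ric h y a c + (\sum_b Sch_shift_up y b b) * h y a c + 2%:R * P y a c.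
Proof.
move=> Oy; rewrite !RicE; under eq_bigr do rewrite Riem_conf//.
have lowP : \sum_b Sch_shift_up y b a * h y b c = P y c a.
  rewrite -[RHS](lower_raise hO c (fun e => P y e a) Oy); apply: eq_bigr => b _.
  by rewrite mulrC hC.
rewrite !sumrB !big_split/= sumrN -!mulr_suml sum_kron lowP kronecker_trace.
by rewrite (Sch_shiftC c a)//; ring.
Qed.

Lemma Scal_conf y : O y -> Scal h' y =
  (th y ^+ 2)^-1 * (Scal h y + 6%:R * \sum_b Sch_shift_up y b b).
Proof.
move=> Oy; rewrite !ScalE.
have trh : \sum_a \sum_b hi y a b * h y a b = 4%:R.
  rewrite -(kronecker_trace R); apply: eq_bigr => a _.
  by rewrite -(ginvK hO a a Oy); apply: eq_bigr => b _; rewrite (hC a b).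
have trP : \sum_a \sum_b hi y a b * P y a b = \sum_b Sch_shift_up y b b.
  by apply: eq_bigr => a _; apply: eq_bigr => b _; rewrite Sch_shiftC.
set t := \sum_b Sch_shift_up y b b.
transitivity ((th y ^+ 2)^-1 * ((\sum_a \sum_b hi y a b * Ric h y a b)
    + t * (\sum_a \sum_b hi y a b * h y a b)
    + 2%:R * (\sum_a \sum_b hi y a b * P y a b))).
  rewrite !mulr_sumr -!big_split/= mulr_sumr; apply: eq_bigr => a _.
  rewrite !mulr_sumr -!big_split/= mulr_sumr; apply: eq_bigr => b _.
  by rewrite ginv_conf// Ric_conf// -/t; ring.
by rewrite trh trP -/t; ring.
Qed.

(** Traces of [Riem_conf]: Ric' = Ric + (tr P) h + 2 P and
Scal' = Theta^-2 (Scal + 6 tr P), so the terms in tr P cancel. *)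
Lemma Sch_conf y a b : O y -> Sch h' y a b = Sch h y a b + P y a b.
Proof.
move=> Oy; rewrite !SchE Scal_conf// Ric_conf// metric_conf//.
by field; exact: th_neq0.
Qed.

(** The change of the Riemann tensor in [Riem_conf] has the shape of the terms
that the Weyl tensor subtracts, with P in place of the Schouten tensor. *)
Lemma Weyl_conf y a b c d : O y -> Weyl h' y a b c d = Weyl h y a b c d.
Proof.
move=> Oy; have upE i : Sch_up h' y d i =
    (th y ^+ 2)^-1 * (Sch_up h y d i + Sch_shift_up y d i).
  rewrite !Sch_upE -big_split mulr_sumr/=; apply: eq_bigr => e _.
  by rewrite ginv_conf// Sch_conf//; ring.
rewrite !WeylE Riem_conf// !upE !Sch_conf// !metric_conf//.
by field; exact: th_neq0.
Qed.

Lemma smooth_hess a b : smooth_on O (fun y => N y a b).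
Proof.
have sG := smooth_Gam Oo hO.
apply: (smooth_ext Oo (f := fun y => pd a (u b) y - \sum_d G y a b d * u d y)).
  by move=> y _; rewrite hessE.
apply: (smoothB Oo (smooth_pd _ (u_smooth _))).
apply: (smooth_sum Oo) => d; exact: (smoothM Oo (sG _ _ _) (u_smooth _)).
Qed.

Lemma smooth_u_sq : smooth_on O Q.
Proof.
apply: (smooth_ext Oo (f := fun y => \sum_c u c y * U y c)) => [y _|].
  by rewrite u_sqE.
apply: (smooth_sum Oo) => c; exact: (smoothM Oo (u_smooth _) (smooth_u_up _)).
Qed.

Lemma smooth_Sch_shift a b : smooth_on O (fun y => P y a b).
Proof.
apply: (smooth_ext Oo (f := fun y =>
    u a y * u b y - N y a b - 2%:R^-1 * Q y * h y a b)) => [y _|].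
  by rewrite Sch_shiftE.
apply: (smoothB Oo).
  exact: (smoothB Oo (smoothM Oo (u_smooth _) (u_smooth _)) (smooth_hess _ _)).
apply: (smoothM Oo _ (smooth_metric hO _ _)).
exact: (smoothM Oo (@smooth_cst _ O _) smooth_u_sq).
Qed.

(** The commutator of covariant derivatives applied to U, with the Christoffel
terms of the outer derivative moved to the right; those in the index pair
m, p cancel by symmetry. *)
Lemma ricci_identity y m p a : O y ->
  pd m (fun z => N z p a) y - pd p (fun z => N z m a) y =
  (\sum_d Riem h y m p a d * u d y)
  + (\sum_d G y m a d * N y p d) - (\sum_d G y p a d * N y m d).
Proof.
move=> Oy; have sG := smooth_Gam Oo hO.
have pdN i j k : pd i (fun z => N z j k) y = pd i (pd j (u k)) y
    - (\sum_d pd i (fun z => G z j k d) y * u d y)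
    - (\sum_d G y j k d * pd i (u d) y).
  have sGu d : smooth_on O (fun z => G z j k d * u d z).
    exact: (smoothM Oo (sG _ _ _) (u_smooth _)).
  rewrite (eq_pd i Oo (g := fun z => pd j (u k) z - \sum_d G z j k d * u d z) _ Oy);
    last by move=> z _; rewrite hessE.
  rewrite (pdB _ (smooth_pd _ (u_smooth _)) (smooth_sum Oo _ sGu) Oy).
  rewrite (pd_sum Oo _ _ sGu Oy) -addrA -opprD -big_split/=.
  congr (_ - _); apply: eq_bigr => d _.
  by rewrite (pdM _ (sG _ _ _) (u_smooth _) Oy); ring.
have GGu i j : \sum_d (\sum_e G y i a e * G y j e d) * u d y =
    \sum_e G y i a e * (pd j (u e) y - N y j e).
  by rewrite -sum_mulA; under eq_bigr do rewrite sum_Gam_u.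
have -> : \sum_d Riem h y m p a d * u d y =
    (\sum_d pd p (fun z => G z m a d) y * u d y)
    - (\sum_d pd m (fun z => G z p a d) y * u d y)
    + (\sum_e G y m a e * (pd p (u e) y - N y p e))
    - (\sum_e G y p a e * (pd m (u e) y - N y m e)).
  rewrite -!GGu -!sumrB -big_split -sumrB/=; apply: eq_bigr => d _.
  by rewrite (RiemE Oo hO)//; ring.
have splitG i j : \sum_e G y i a e * (pd j (u e) y - N y j e) =
    (\sum_e G y i a e * pd j (u e) y) - \sum_e G y i a e * N y j e.
  by rewrite -sumrB; apply: eq_bigr => e _; rewrite mulrBr.
rewrite !pdN !splitG (pdC Oo m p (u_smooth a) Oy).
by ring.
Qed.

Lemma pd_u_sq y m : O y ->
  pd m Q y = 2%:R * \sum_e U y e * N y m e.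
Proof.
move=> Oy; have su c : smooth_on O (fun z => u c z * U z c).
  exact: (smoothM Oo (u_smooth _) (smooth_u_up _)).
rewrite (eq_pd m Oo (g := fun z => \sum_c u c z * U z c) _ Oy); last first.
  by move=> z _; rewrite u_sqE.
rewrite (pd_sum Oo _ _ su Oy).
under eq_bigr do rewrite (pdM _ (u_smooth _) (smooth_u_up _) Oy) pd_u_up// mulrBr.
rewrite big_split sumrB/= sum_mulA.
have -> : \sum_e (\sum_c u c y * hi y c e) * N y m e = \sum_e U y e * N y m e.
  apply: eq_bigr => e _; rewrite u_upE; congr (_ * _); apply: eq_bigr => c _.
  by rewrite mulrC hiC.
rewrite sum_mulA.
have -> : \sum_e (\sum_c u c y * G y m e c) * U y e =
    \sum_e U y e * (pd m (u e) y - N y m e).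
  apply: eq_bigr => e _; rewrite mulrC -sum_Gam_u; congr (_ * _).
  by apply: eq_bigr => c _; rewrite mulrC.
rewrite mulr_sumr -sumrB -big_split/=; apply: eq_bigr => e _.
by ring.
Qed.

(** Y_{mpa} = nabla_m L_{pa} - nabla_p L_{ma}; the Christoffel terms in the pair
m, p have cancelled. *)
Definition cotton (k : V -> 'M[R]_4) y m p a : R :=
  pd m (fun z => Sch k z p a) y - pd p (fun z => Sch k z m a) y
  - (\sum_d Gam k y m a d * Sch k y p d) + \sum_d Gam k y p a d * Sch k y m d.

(** By [ricci_identity] the derivative of the Hessian inside P contributes
-R_{mpa}^d U_d. The terms quadratic in U and the Hessian cancel against those of
S P, and S L supplies the Schouten terms that complete the Riemann tensor to
the Weyl tensor. *)
Lemma cotton_conf y m p a : O y ->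
  cotton h' y m p a = cotton h y m p a - \sum_f Weyl h y m p a f * u f y.
Proof.
move=> Oy; have sL := smooth_Sch Oo hO; have sP := smooth_Sch_shift.
have dL' i j k : pd i (fun z => Sch h' z j k) y =
    pd i (fun z => Sch h z j k) y + pd i (fun z => P z j k) y.
  rewrite -(pdD _ (sL _ _) (sP _ _) Oy).
  by apply: (eq_pd _ Oo _ Oy) => z Oz; rewrite Sch_conf.
have GL' i j : \sum_d Gam h' y i a d * Sch h' y j d =
    (\sum_d G y i a d * Sch h y j d) + (\sum_d G y i a d * P y j d)
    + \sum_d S y i a d * (Sch h y j d + P y j d).
  rewrite -!big_split/=; apply: eq_bigr => d _.
  by rewrite Gam_conf// Sch_conf//; ring.
have GP i j : \sum_d G y i a d * P y j d =
    u j y * (pd i (u a) y - N y i a) - (\sum_d G y i a d * N y j d)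
    - 2%:R^-1 * Q y * Gd y j i a.
  rewrite -sum_Gam_u Gam_downE !mulr_sumr -!sumrB; apply: eq_bigr => d _.
  by rewrite Sch_shiftE; ring.
have UP i : \sum_d U y d * P y i d =
    2%:R^-1 * Q y * u i y - \sum_d U y d * N y i d.
  transitivity (u i y * Q y - (\sum_d U y d * N y i d)
      - 2%:R^-1 * Q y * \sum_d h y i d * U y d); last by rewrite lower_u_up//; field.
  rewrite [in LHS](eq_bigr (fun d => u i y * (u d y * U y d) - U y d * N y i d
      - 2%:R^-1 * Q y * (h y i d * U y d))) => [|d _]; last first.
    by rewrite Sch_shiftE; ring.
  by rewrite !sumrB -!mulr_sumr -u_sqE.
have dP i j : pd i (fun z => P z j a) y =
    pd i (u j) y * u a y + u j y * pd i (u a) y - pd i (fun z => N z j a) y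
    - (\sum_e U y e * N y i e) * h y j a
    - 2%:R^-1 * Q y * (Gd y a i j + Gd y j i a).
  have sc := @smooth_cst _ O (2%:R^-1 : R).
  have sQ := smooth_u_sq; have sh := smooth_metric hO j a.
  rewrite (eq_pd i Oo (g := fun z =>
    u j z * u a z - N z j a - 2%:R^-1 * Q z * h z j a) _ Oy); last first.
    by move=> z _; rewrite Sch_shiftE.
  rewrite (pdB _ (smoothB Oo (smoothM Oo (u_smooth _) (u_smooth _))
    (smooth_hess _ _)) (smoothM Oo (smoothM Oo sc sQ) sh) Oy).
  rewrite (pdB _ (smoothM Oo (u_smooth _) (u_smooth _)) (smooth_hess _ _) Oy).
  rewrite (pdM _ (u_smooth _) (u_smooth _) Oy) (pdM _ (smoothM Oo sc sQ) sh Oy).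
  rewrite (pdZ _ _ sQ Oy) pd_u_sq// (pd_metric Oo hO)//.
  by field.
have WU : \sum_f Weyl h y m p a f * u f y =
    (\sum_f Riem h y m p a f * u f y)
    - (\sum_f U y f * Sch h y p f) * h y m a
    + (\sum_f U y f * Sch h y m f) * h y p a
    - u p y * Sch h y m a + u m y * Sch h y p a.
  have SU i : \sum_f Sch_up h y f i * u f y = \sum_f U y f * Sch h y i f.
    under eq_bigr do rewrite Sch_upE mulr_suml.
    rewrite exchange_big; apply: eq_bigr => e _/=; rewrite u_upE mulr_suml.
    apply: eq_bigr => d _.
    by rewrite (hiC d e)// (SchC Oo hO Oy i e); ring.
  rewrite -!SU -(sum_kron_col (fun f => u f y) p) -(sum_kron_col (fun f => u f y) m).
  rewrite !mulr_suml -!sumrB -!big_split -!sumrB -!big_split/=.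
  by apply: eq_bigr => f _; rewrite WeylE; ring.
have SPU i : \sum_d U y d * (Sch h y i d + P y i d) =
    (\sum_d U y d * Sch h y i d) + \sum_d U y d * P y i d.
  by rewrite -big_split/=; apply: eq_bigr => d _; rewrite mulrDr.
have := ricci_identity m p a Oy.
set A := pd m _ y; set B := pd p _ y => RI.
have AE : A = B + (\sum_d Riem h y m p a d * u d y)
  + (\sum_d G y m a d * N y p d) - (\sum_d G y p a d * N y m d).
  by move/eqP: RI; rewrite subr_eq => /eqP ->; ring.
rewrite /cotton !dL' !GL' !sum_shift_l !SPU !UP !GP !dP WU -/A -/B AE.
rewrite (SchC Oo hO Oy p m) (Sch_shiftC p m)// (u_closed p m)//.
rewrite (Gam_downC Oo hO a p m)// !Sch_shiftE.
by field.
Qed.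

Lemma Weyl_mixed_conf y a b c d : O y ->
  Weyl_mixed h' y a b c d = (th y ^+ 2)^-1 * Weyl_mixed h y a b c d.
Proof.
move=> Oy; rewrite !Weyl_mixedE mulr_sumr; apply: eq_bigr => e _.
by rewrite ginv_conf// Weyl_conf// mulrA.
Qed.

(** Each factor C_{ab}^{cd} contains one inverse metric, hence Theta^-4. *)
Lemma weyl_square_conf y : O y ->
  weyl_square h' y = (th y ^+ 4)^-1 * weyl_square h y.
Proof.
move=> Oy; rewrite (Weyl_squareE Oo hO' Oy) (Weyl_squareE Oo hO Oy) /square_trace.
do 4 (rewrite mulr_sumr; apply: eq_bigr => ? _).
by rewrite !Weyl_mixed_conf//; field; exact: th_neq0.
Qed.

(** Numerator and denominator both scale by Theta^-4; the shift of the Cotton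
tensor adds -4 C_d^{amp} C_{mpa}^f U_f = (C.C) U_d to the numerator. *)
Lemma Lambda_conf y d : O y -> weyl_square h' y != 0 ->
  Lambda h' y d = Lambda h y d + u d y.
Proof.
move=> Oy; rewrite /Lambda weyl_square_conf// mulf_eq0 negb_or => /andP[_ w0].
have t0 := th_neq0 Oy.
have altE k : metric_on O k -> forall m p a,
    alt (fun m p => nabla2 k (schouten k) y m p a) m p = 2%:R^-1 * cotton k y m p a.
  move=> kO m p a; rewrite /alt /nabla2 /cotton schouten_Sch christoffel_Gam partial_pd.
  have -> : \sum_d Gam k y p m d * Sch k y d a = \sum_d Gam k y m p d * Sch k y d a.
    by apply: eq_bigr => e _; rewrite (GamC Oo kO p m).
  by field.
have up3' a b c e :
    weyl_up3 h' y a b c e = (th y ^+ 4)^-1 * weyl_up3 h y a b c e.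
  rewrite !Weyl_up3E mulr_sumr; apply: eq_bigr => f _.
  by rewrite ginv_conf// Weyl_mixed_conf//; field.
have -> : \sum_a \sum_m \sum_p weyl_up3 h' y d a m p *
      alt (fun m p => nabla2 h' (schouten h') y m p a) m p =
    (th y ^+ 4)^-1 * ((\sum_a \sum_m \sum_p weyl_up3 h y d a m p *
      alt (fun m p => nabla2 h (schouten h) y m p a) m p)
    - 2%:R^-1 * \sum_a \sum_m \sum_p weyl_up3 h y d a m p *
        (\sum_f Weyl h y m p a f * u f y)).
  do 3 (rewrite !mulr_sumr -sumrB mulr_sumr; apply: eq_bigr => ? _).
  by rewrite up3' !altE// cotton_conf//; ring.
rewrite (Weyl_contraction Oo hO Oy d (fun f => u f y)).
by field; rewrite t0 w0.
Qed.

End ConformalChange.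

(** * Powers of the conformal factor, and the theorem *)

Section LogarithmicDerivative.
Variable R : realType.
Local Notation V := 'rV[R]_4.
Variables (O : set V) (th : V -> R).
Hypothesis Oo : open O.
Hypothesis th_neq0 : forall y, O y -> th y != 0.
Hypothesis th_smooth : smooth_on O th.
Implicit Types (a b : 'I_4) (y : V).

(** Using the quotient rather than the derivative of a logarithm keeps within
the ring of smooth functions. *)
Definition dlog a y : R := pd a th y / th y.

Lemma smooth_dlog a : smooth_on O (dlog a).
Proof. exact: (smoothM Oo (smooth_pd a th_smooth) (smoothV Oo th_neq0 th_smooth)). Qed.

Lemma pd_dlog a y : O y -> pd a th y = th y * dlog a y.
Proof. by move=> Oy; rewrite /dlog mulrC divfK// th_neq0. Qed.

(** Differentiating d_b th = th U_b once more and comparing the two orders. *)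
Lemma dlog_closed a b y : O y -> pd a (dlog b) y = pd b (dlog a) y.
Proof.
move=> Oy; have E i j : pd i (pd j th) y =
    th y * pd i (dlog j) y + dlog j y * (th y * dlog i y).
  rewrite -pd_dlog// -(pdM _ th_smooth (smooth_dlog j) Oy).
  by apply: (eq_pd _ Oo _ Oy) => z; exact: pd_dlog.
apply: (mulfI (th_neq0 Oy)); have := pdC Oo a b th_smooth Oy.
by rewrite !E => /eqP; rewrite -subr_eq => /eqP <-; ring.
Qed.

Lemma exprz_smooth (s : int) : smooth_on O (fun z => th z ^ s).
Proof.
have nat_smooth n : smooth_on O (fun z => th z ^+ n).
  elim: n => [|n IHn]; first exact: smooth_cst.
  by apply: (smooth_ext Oo _ (smoothM Oo th_smooth IHn)) => z _; rewrite exprS.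
case: s => n; first exact: nat_smooth.
by apply: (smoothV Oo _ (nat_smooth n.+1)) => z /th_neq0; exact: expf_neq0.
Qed.

(** For negative [s] the formula follows by differentiating
th^s th^(-s) = 1. *)
Lemma pd_exprz (s : int) a y : O y ->
  pd a (fun z => th z ^ s) y = s%:~R * dlog a y * th y ^ s.
Proof.
move=> Oy; have nat_pd n : pd a (fun z => th z ^ n%:Z) y =
    n%:R * dlog a y * th y ^ n%:Z.
  elim: n => [|n IHn]; first by rewrite pd_cst !mul0r.
  rewrite (eq_pd a Oo (g := fun z => th z * th z ^ n%:Z) _ Oy); last first.
    by move=> z _; rewrite -exprSz.
  rewrite (pdM _ th_smooth (exprz_smooth n) Oy) IHn pd_dlog// -natr1 exprSz.
  by ring.
case: s => n; first by rewrite nat_pd.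
have : pd a (fun z => th z ^ Negz n * th z ^ n.+1%:Z) y = 0.
  rewrite -[RHS](pd_cst a (1 : R) y); apply: (eq_pd _ Oo _ Oy) => z Oz.
  by rewrite NegzE -exprz_inv -expfzMl mulVf ?th_neq0// exp1rz.
rewrite (pdM _ (exprz_smooth _) (exprz_smooth _) Oy) nat_pd => E.
apply: (mulfI (expfz_neq0 n.+1%:Z (th_neq0 Oy))).
move/eqP: E; rewrite addrC addr_eq0 => /eqP ->.
by rewrite NegzE mulrNz; ring.
Qed.

End LogarithmicDerivative.

Lemma chart_invP (R : realType) (M : topologicalType) (c : chart R M) z :
  chart_cod c z -> exists2 x, chart_dom c x & z = c x /\ chart_inv c z = x.
Proof. by move=> [x cx <-]; exists x => //; rewrite chart_mapK. Qed.

Lemma metric_on_chart (R : realType) (M : manifold4 R) (g : metric M) c :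
  atlas c -> metric_on (chart_cod c) (in_chart g c).
Proof.
move=> ac; split=> [a b|z|z].
- exact: metric_smooth.
- by move=> /chart_invP[x cx [_ zx]]; rewrite /in_chart zx Defs.metric_sym.
- by move=> /chart_invP[x cx [_ zx]]; rewrite /in_chart zx metric_nondegenerate.
Qed.

Theorem theorem1 (R : realType) (M : manifold4 R) (g gt : metric M)
  (Theta : M -> R)
  (Theta_smooth : smooth_fun Theta)
  (Theta_gt0 : forall x : M, 0 < Theta x)
  (g_gt : conformally_related g gt Theta)
  (weyl_neq0 : weyl_square_nowhere_zero g)
  (W : metric M -> M -> R)
  (W_concomitant : scalar_metric_concomitant W)
  (w_smooth : smooth_fun (W g))
  (s : int)
  (w_covariant : forall x : M, W gt x = Theta x ^ s * W g x) :
  forall (c : chart R M) (x : M) (a : 'I_4), atlas c -> chart_dom c x ->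
    D_op gt s (W gt) c x a = Theta x ^ s * D_op g s (W g) c x a.
Proof.
move=> c x a ac cx; have Oo := @chart_cod_open _ _ c.
have Oy : chart_cod c (c x) by exists x.
pose th := Theta \o chart_inv c; pose w := W g \o chart_inv c.
have th_neq0 z : chart_cod c z -> th z != 0 by rewrite gt_eqF// Theta_gt0.
have th_smooth := Theta_smooth c ac; have w_sm := w_smooth c ac.
have h'E z : chart_cod c z -> in_chart g c z = th z ^+ 2 *: in_chart gt c z.
  move=> /chart_invP[x' cx' [_ zx]].
  by rewrite /in_chart /th /= zx; exact: g_gt.
have := Lambda_conf Oo (metric_on_chart gt ac) (metric_on_chart g ac) th_neq0
  th_smooth h'E (smooth_dlog Oo th_neq0 th_smooth) (pd_dlog th_neq0)
  (dlog_closed Oo th_neq0 th_smooth) a Oy (weyl_neq0 c x ac cx).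
rewrite /D_op => ->.
have -> : W gt \o chart_inv c = fun z => th z ^ s * w z.
  by apply/funext => z; rewrite /= w_covariant.
rewrite partial_pd (pdM _ (exprz_smooth Oo th_neq0 th_smooth s) w_sm Oy).
rewrite (pd_exprz Oo th_neq0 th_smooth)// w_covariant /w /th /= chart_mapK//.
by ring.
Qed.
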